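(* Let $E: BL_+(\mathbb{R})\to \mathrm{Hom}(\mathbb{H})$ be an admissible extension. Assume there are $z_0\in\mathbb{H}$, $\varepsilon_0\in(0,1)$ and a bounded linear functional $\Lambda: C^1_0(\mathbb{R})\to\mathbb{C}$ such that $$E(\mathrm{Id}+\varphi)(z_0)=z_0+\Lambda(\varphi)+R(\varphi)$$ for every $\varphi\in\mathcal{B}_\infty(\varepsilon_0)$, where $R:\mathcal{B}_\infty(\varepsilon_0)\to\mathbb{C}$ is a function with the following property: for every $c>0$ there is $\varepsilon\in(0,\varepsilon_0)$ such that $|R(\varphi)|\le c\,\|\varphi'\|_\infty^2$ for all $\varphi\in\mathcal{B}_\infty(\varepsilon)$. Then there exist $a\in\mathbb{R}$ and $\alpha\ge0$ such that $\Lambda=\mathcal{E}_{a,\alpha}$, i.e. $\Lambda(\varphi)=\mathcal{E}_{a,\alpha}\varphi(z_0)$ for all $\varphi\in C^1_0(\mathbb{R})$.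
   Context: $\mathbb{H}=\{z=x+iy: x\in\mathbb{R},\ y>0\}$. $\mathrm{Hom}(\mathbb{H})$ is the class of homeomorphisms of $\mathbb{H}$ onto itself. $\mathrm{Id}$ is the identity function. $BL_+(\mathbb{R})$ is the set of $f\in C^1(\mathbb{R})$, $f:\mathbb{R}\to\mathbb{R}$, for which there are $b,B>0$ with $b\le f'(x)\le B$ for all $x\in\mathbb{R}$. For $f_n,f\in BL_+(\mathbb{R})$ write $f_n\xrightarrow{BL_+(\mathbb{R})}f$ if $f_n\to f$ and $f_n'\to f'$ uniformly on compact sets of $\mathbb{R}$ and there are $b,B>0$ such that $b\le f_n'(x)\le B$ for all $n\ge1$ and $x\in\mathbb{R}$. A map $E:BL_+(\mathbb{R})\to\mathrm{Hom}(\mathbb{H})$ is an admissible extension if: (P1) for every $f\in BL_+(\mathbb{R})$, $\lim_{y\to0^+}Ef(x+iy)=f(x)$ uniformly for $x$ in compact sets of $\mathbb{R}$; (P2) $E(a\,\mathrm{Id}+b)(z)=az+b$ for every $a>0$, $b\in\mathbb{R}$; (P3) $E(f\circ g)=Ef\circ Eg$ for all $f,g\in BL_+(\mathbb{R})$; (P4) if $f_n\xrightarrow{BL_+(\mathbb{R})}f$ then $Ef_n(z)\to Ef(z)$ for all $z\in\mathbb{H}$. $C^\infty_c(\mathbb{R})$ is the real vector space of infinitely differentiable compactly supported functions $\varphi:\mathbb{R}\to\mathbb{R}$, and $\mathcal{B}_\infty(\varepsilon)=\{\varphi\in C^\infty_c(\mathbb{R}):\|\varphi'\|_\infty<\varepsilon\}$.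 $C^1_0(\mathbb{R})$ is the real Banach space of $C^1$ functions $\varphi:\mathbb{R}\to\mathbb{R}$ such that $\varphi$ and $\varphi'$ both converge to zero at $\pm\infty$, with norm $\|\varphi\|_{1,\infty}=\|\varphi\|_\infty+\|\varphi'\|_\infty$. For $a\in\mathbb{R}$, $\alpha>0$ and $z=x+iy\in\mathbb{H}$, and any $C^1$ function $f:\mathbb{R}\to\mathbb{R}$, $$\mathcal{E}_{a,\alpha}f(z)=(1-\tfrac a\alpha)f(x+ay)+\tfrac a\alpha f(x-(\alpha-a)y)+\tfrac i\alpha f(x+ay)-\tfrac i\alpha f(x-(\alpha-a)y),$$ and for $\alpha=0$, $$\mathcal{E}_{a,0}f(z)=f(x+ay)-ay f'(x+ay)+iyf'(x+ay).$$ *)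

(* Defs.v *)
(* Stdlib reals with Coquelicot.  Maps and functionals whose domain is a set
   of functions or a subset of C are total functions constrained only on that
   domain; their values elsewhere are irrelevant. *)
From Stdlib Require Import Reals.
From Coquelicot Require Import Coquelicot.

Open Scope R_scope.

Definition upper_half_plane (z : C) : Prop := 0 < Im z.

(* The restriction of [h] to the upper half-plane is a homeomorphism of the
   upper half-plane onto itself. *)
Definition Hom_H (h : C -> C) : Prop :=
  (forall z, upper_half_plane z -> upper_half_plane (h z)) /\
  continuous_on upper_half_plane h /\
  exists g : C -> C,
    (forall z, upper_half_plane z -> upper_half_plane (g z)) /\
    continuous_on upper_half_plane g /\
    (forall z, upper_half_plane z -> g (h z) = z) /\
    (forall z, upper_half_plane z -> h (g z) = z).

Definition C1 (f : R -> R) : Prop :=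
  (forall x, ex_derive f x) /\ (forall x, continuous (Derive f) x).

Definition derive_between (b B : R) (f : R -> R) : Prop :=
  forall x, b <= Derive f x <= B.

Definition BLplus (f : R -> R) : Prop :=
  C1 f /\ exists b B, 0 < b /\ 0 < B /\ derive_between b B f.

Definition cv_uniform_on_compacts (fn : nat -> R -> R) (f : R -> R) : Prop :=
  forall K : R -> Prop, compact K ->
  forall eps, 0 < eps ->
  exists N : nat, forall n, (N <= n)%nat ->
  forall x, K x -> Rabs (fn n x - f x) < eps.

Definition BLplus_cv (fn : nat -> R -> R) (f : R -> R) : Prop :=
  cv_uniform_on_compacts fn f /\
  cv_uniform_on_compacts (fun n => Derive (fn n)) (Derive f) /\
  exists b B, 0 < b /\ 0 < B /\ forall n, derive_between b B (fn n).

Record admissible_extension (E : (R -> R) -> C -> C) : Prop := {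
  adm_hom : forall f, BLplus f -> Hom_H (E f);
  adm_boundary : forall f, BLplus f ->
    forall K : R -> Prop, compact K ->
    forall eps, 0 < eps ->
    exists delta, 0 < delta /\
    forall x y, K x -> 0 < y < delta ->
    Cmod (E f (x, y) - RtoC (f x))%C < eps;
  adm_affine : forall a b, 0 < a ->
    forall z, upper_half_plane z ->
    E (fun x => a * x + b) z = (RtoC a * z + RtoC b)%C;
  adm_comp : forall f g, BLplus f -> BLplus g ->
    forall z, upper_half_plane z ->
    E (fun x => f (g x)) z = E f (E g z);
  adm_cv : forall (fn : nat -> R -> R) (f : R -> R),
    (forall n, BLplus (fn n)) -> BLplus f -> BLplus_cv fn f ->
    forall z, upper_half_plane z ->
    filterlim (fun n => E (fn n) z) eventually (locally (E f z))
}.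

(* The supremum norm of a bounded function; [real] sends an infinite supremum
   to 0, so this is meaningful for bounded functions only. *)
Definition sup_norm (f : R -> R) : R :=
  real (Lub_Rbar (fun r => exists x, r = Rabs (f x))).

(* [adherence] is the topological closure. *)
Definition Cinfty_c (phi : R -> R) : Prop :=
  (forall (n : nat) (x : R), ex_derive_n phi n x) /\
  compact (adherence (fun x => phi x <> 0)).

Definition B_infty (eps : R) (phi : R -> R) : Prop :=
  Cinfty_c phi /\ sup_norm (Derive phi) < eps.

Definition C1_0 (phi : R -> R) : Prop :=
  C1 phi /\
  is_lim phi p_infty 0 /\ is_lim phi m_infty 0 /\
  is_lim (Derive phi) p_infty 0 /\ is_lim (Derive phi) m_infty 0.

Definition norm_1_infty (phi : R -> R) : R :=
  sup_norm phi + sup_norm (Derive phi).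

Record bounded_linear_C1_0 (Lambda : (R -> R) -> C) : Prop := {
  bl_plus : forall phi psi, C1_0 phi -> C1_0 psi ->
    Lambda (fun x => phi x + psi x) = (Lambda phi + Lambda psi)%C;
  bl_scal : forall c phi, C1_0 phi ->
    Lambda (fun x => c * phi x) = (RtoC c * Lambda phi)%C;
  bl_bound : exists M, forall phi, C1_0 phi ->
    Cmod (Lambda phi) <= M * norm_1_infty phi
}.

Definition ext_family (a alpha : R) (f : R -> R) (z : C) : C :=
  let x := Re z in
  let y := Im z in
  let p := x + a * y in
  let q := x - (alpha - a) * y in
  if Req_EM_T alpha 0 then
    (RtoC (f p) - RtoC (a * y)%R * RtoC (Derive f p)
     + Ci * RtoC y * RtoC (Derive f p))%C
  else
    (RtoC (1 - a / alpha)%R * RtoC (f p) + RtoC (a / alpha)%R * RtoC (f q)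
     + Ci / RtoC alpha * RtoC (f p) - Ci / RtoC alpha * RtoC (f q))%C.

(* Main.v *)
(* Precomposing with affine maps turns the expansion of [E] at [z0] into an
   expansion at every point of the upper half-plane.  Expanding both sides of
   [E ((Id + t phi) o (Id + t psi)) = E (Id + t phi) o E (Id + t psi)] at [z0]
   and comparing the terms of order [t ^ 2] gives, with [m x = (x - x0) / y0],
     [L (psi phi') = Re (L psi) L phi' + Im (L psi) L (m phi')]
   for all test functions.  Hence the kernel of [L] on the test functions is
   stable under multiplication by [x], and as it has codimension two,
   Cayley-Hamilton gives a real monic quadratic [P] with [L (P f) = 0] for every
   test function [f].  If [P] had no real root, division by [P] would give
   [L = 0]; so [P = (x - p) (x - q)] and [L f] depends only on [f p] and the
   divided difference [f [p, q]].  Continuity of [E] along cutoffs of affine maps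
   yields the normalization "[L 1 = 1] and [L Id = z0]", which determines the two
   coefficients, and density of the test functions in [C1_0] concludes. *)
Require Import Defs.
From Stdlib Require Import Reals Lra Lia FunctionalExtensionality.
From Coquelicot Require Import Coquelicot.
Open Scope R_scope.

(** * Smooth functions *)

(** The remainder is little-o of the squared slope, not merely big-O. This turns the comparison at
    order [t ^ 2] into an exact identity, where a big-O remainder would leave an unknown term of the
    same order. In that identity [psi] enters the right-hand side only through the number [L psi].
    Choosing [phi] with derivative [m] on the support of [psi] thus makes [L (m psi)] a real-linear
    function of [L psi], which is the source of the stability of the kernel. The main obstacle is
    that 1, [Id] and all polynomials lie outside the domain of [L], and their truncations do not
    converge in the norm that controls [L]. Truncated affine maps do keep slopes bounded uniformly
    in the truncation, so for a fixed small [t] the maps [Id + t eta_n] converge to an affine map,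
    where [E] is known; the error of order [t ^ 2] becomes negligible after division by [t]. The
    same truncations show that [L] takes every complex value, hence the codimension two. Division by
    [x - p] has to stay within compactly supported smooth functions, which calls for Hadamard's
    lemma. *)

Fixpoint diffn (n : nat) (f : R -> R) : Prop :=
  match n with
  | O => True
  | S n => exists f', (forall x, is_derive f x (f' x)) /\ diffn n f'
  end.

(** The recursion of [diffn] makes closure under products and compositions a plain induction on the
    order; [smooth_ex_derive_n] recovers the form used by [Cinfty_c]. *)
Definition smooth (f : R -> R) : Prop := forall n, diffn n f.

Lemma diffn_S (n : nat) (f : R -> R) : diffn (S n) f -> diffn n f.
Proof.
  revert f; induction n as [|n IH]; intros f H; [exact I|].
  destruct H as [g [Hg Hn]]; exists g; split; [exact Hg | now apply IH].
Qed.

Lemma smooth_intro (f f' : R -> R) :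
  (forall x, is_derive f x (f' x)) -> smooth f' -> smooth f.
Proof. intros H Hs [|n]; [exact I | exists f'; auto]. Qed.

Lemma smooth_ex_derive (f : R -> R) (x : R) : smooth f -> ex_derive f x.
Proof. intros H; destruct (H 1%nat) as [g [Hg _]]; exists (g x); apply Hg. Qed.

Lemma smooth_is_derive (f : R -> R) (x : R) :
  smooth f -> is_derive f x (Derive f x).
Proof. intros H; now apply Derive_correct, smooth_ex_derive. Qed.

Lemma smooth_Derive (f : R -> R) : smooth f -> smooth (Derive f).
Proof.
  intros H n; destruct (H (S n)) as [g [Hg Hn]].
  replace (Derive f) with g; [exact Hn|].
  apply functional_extensionality; intros x; symmetry; now apply is_derive_unique.
Qed.

Lemma smooth_continuous (f : R -> R) (x : R) : smooth f -> continuous f x.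
Proof. intros H; apply (ex_derive_continuous f), smooth_ex_derive, H. Qed.

Lemma smooth_Derive_n (f : R -> R) (n : nat) : smooth f -> smooth (Derive_n f n).
Proof. intros H; induction n as [|n IH]; [exact H | now apply smooth_Derive]. Qed.

(** [Derive_n] adds each new derivative outermost while [diffn] strips the innermost one, so the
    converse exchanges the two orders by [Derive_n_comp]. *)
Lemma smooth_ex_derive_n (f : R -> R) :
  smooth f <-> forall n x, ex_derive_n f n x.
Proof.
  split.
  - intros H [|n] x; [exact I|].
    now apply smooth_ex_derive, smooth_Derive_n.
  - intros H n; revert f H; induction n as [|n IH]; intros f H; [exact I|].
    exists (Derive f); split.
    + intros x; apply Derive_correct, (H 1%nat x).
    + apply IH; intros [|k] x; [exact I|].
      generalize (H (S (S k)) x); simpl; apply ex_derive_ext; intros y.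
      replace (Derive (Derive_n f k) y) with (Derive_n f (k + 1) y).
      * symmetry; exact (Derive_n_comp f k 1 y).
      * now rewrite Nat.add_1_r.
Qed.

Lemma diffn_const (n : nat) (c : R) : diffn n (fun _ => c).
Proof.
  revert c; induction n as [|n IH]; intros c; [exact I|].
  exists (fun _ => 0); split; [|apply IH].
  intros x; apply (is_derive_const c).
Qed.

Lemma diffn_plus (n : nat) (f g : R -> R) :
  diffn n f -> diffn n g -> diffn n (fun x => f x + g x).
Proof.
  revert f g; induction n as [|n IH]; intros f g; [easy|].
  intros [f' [Hf Hf']] [g' [Hg Hg']].
  exists (fun x => f' x + g' x); split; [|now apply IH].
  intros x; now apply (is_derive_plus f g).
Qed.

Lemma diffn_mult (n : nat) (f g : R -> R) :
  diffn n f -> diffn n g -> diffn n (fun x => f x * g x).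
Proof.
  revert f g; induction n as [|n IH]; intros f g; [easy|].
  intros Hf0 Hg0; generalize Hf0 Hg0.
  intros [f' [Hf Hf']] [g' [Hg Hg']].
  exists (fun x => f' x * g x + f x * g' x); split.
  - intros x; apply (is_derive_mult f g x); auto; apply Rmult_comm.
  - apply diffn_plus; apply IH; auto using diffn_S.
Qed.

Lemma diffn_comp (n : nat) (f g : R -> R) :
  diffn n f -> diffn n g -> diffn n (fun x => f (g x)).
Proof.
  revert f g; induction n as [|n IH]; intros f g; [easy|].
  intros Hf0 Hg0; generalize Hf0 Hg0.
  intros [f' [Hf Hf']] [g' [Hg Hg']].
  exists (fun x => g' x * f' (g x)); split.
  - intros x; now apply (is_derive_comp f g x).
  - apply diffn_mult; auto; apply IH; auto using diffn_S.
Qed.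

Lemma diffn_inv (n : nat) (f : R -> R) :
  (forall x, f x <> 0) -> diffn n f -> diffn n (fun x => / f x).
Proof.
  intros Hnz; induction n as [|n IH]; [easy|].
  intros Hf; generalize Hf; intros [f' [Hd Hn]].
  (* The derivative is written as a product containing [/ f x] itself, so that the induction
     hypothesis applies to it. *)
  exists (fun x => (-1) * f' x * (/ f x * / f x)); split.
  - intros x; replace ((-1) * f' x * (/ f x * / f x)) with (- f' x / f x ^ 2).
    + apply is_derive_inv; auto.
    + field; auto.
  - assert (diffn n (fun x => / f x)) by (apply IH, diffn_S, Hf).
    repeat apply diffn_mult; auto using diffn_const.
Qed.

Lemma smooth_const (c : R) : smooth (fun _ => c).
Proof. intros n; apply diffn_const. Qed.

Lemma smooth_id : smooth (fun x => x).
Proof.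
  apply smooth_intro with (fun _ => 1); [|apply smooth_const].
  intros x; apply (is_derive_id x).
Qed.

Lemma smooth_plus (f g : R -> R) :
  smooth f -> smooth g -> smooth (fun x => f x + g x).
Proof. intros Hf Hg n; now apply diffn_plus. Qed.

Lemma smooth_mult (f g : R -> R) :
  smooth f -> smooth g -> smooth (fun x => f x * g x).
Proof. intros Hf Hg n; now apply diffn_mult. Qed.

Lemma smooth_comp (f g : R -> R) :
  smooth f -> smooth g -> smooth (fun x => f (g x)).
Proof. intros Hf Hg n; now apply diffn_comp. Qed.

Lemma smooth_inv (f : R -> R) :
  (forall x, f x <> 0) -> smooth f -> smooth (fun x => / f x).
Proof. intros H Hf n; now apply diffn_inv. Qed.

Lemma smooth_opp (f : R -> R) : smooth f -> smooth (fun x => - f x).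
Proof.
  intros H; replace (fun x => - f x) with (fun x => (-1) * f x).
  - apply smooth_mult; [apply smooth_const | exact H].
  - apply functional_extensionality; intros x; ring.
Qed.

Lemma smooth_minus (f g : R -> R) :
  smooth f -> smooth g -> smooth (fun x => f x - g x).
Proof. intros Hf Hg; apply smooth_plus; [exact Hf | now apply smooth_opp]. Qed.

Ltac solve_smooth :=
  repeat match goal with
  | |- smooth (fun x => x) => apply smooth_id
  | |- smooth (fun _ => ?c) => apply smooth_const
  | |- smooth (Rmult ?a) => apply (smooth_mult (fun _ => a) (fun x => x))
  | H : smooth ?f |- smooth ?f => exact H
  | H : smooth ?f |- smooth (fun x => ?f x) => exact H
  | |- smooth (Derive _) => apply smooth_Derive
  | |- smooth (fun x => _ + _) => apply smooth_plus
  | |- smooth (fun x => _ - _) => apply smooth_minus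
  | |- smooth (fun x => _ * _) => apply smooth_mult
  | |- smooth (fun x => - _) => apply smooth_opp
  | |- smooth (fun x => _ / _) => apply smooth_mult
  | H : smooth ?f |- smooth (fun x => ?f (@?g x)) => apply (smooth_comp f g)
  | |- smooth (fun x => Derive ?f (@?g x)) => apply (smooth_comp (Derive f) g)
  end.

(* The integral representation of the difference quotient of a primitive of [f]. *)
Definition hadamard (k : nat) (f : R -> R) (x : R) : R :=
  RInt (fun s => s ^ k * f (s * x)) 0 1.

Lemma hadamard_continuous (k : nat) (f : R -> R) (x s : R) :
  smooth f -> continuous (fun s => s ^ k * f (s * x)) s.
Proof.
  intros Hf; apply (ex_derive_continuous (fun s => s ^ k * f (s * x))).
  assert (ex_derive f (s * x)) by now apply smooth_ex_derive.
  auto_derive; auto.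
Qed.

(** Differentiation under the integral sign brings out one factor [s]. The exponent [k] records
    these factors and keeps the family closed under derivation, whence its smoothness. *)
Lemma is_derive_hadamard (k : nat) (f : R -> R) (x : R) :
  smooth f -> is_derive (hadamard k f) x (hadamard (S k) (Derive f) x).
Proof.
  intros Hf; unfold hadamard.
  assert (Hd : forall y s, is_derive (fun u => s ^ k * f (s * u)) y
                             (s ^ S k * Derive f (s * y))).
  { intros y s.
    assert (ex_derive f (s * y)) by now apply smooth_ex_derive.
    auto_derive; [auto|simpl; change (fun x0 => f x0) with f; ring]. }
  replace (RInt (fun s => s ^ S k * Derive f (s * x)) 0 1)
    with (RInt (fun s => Derive (fun u => s ^ k * f (s * u)) x) 0 1).
  - apply (is_derive_RInt_param (fun u s => s ^ k * f (s * u))).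
    + apply filter_forall; intros y s _; eexists; apply Hd.
    + intros s _.
      apply continuity_2d_pt_ext with (fun u v => v ^ S k * Derive f (v * u)).
      { intros u v; symmetry; apply is_derive_unique, Hd. }
      apply continuity_2d_pt_mult.
      * apply (continuity_1d_2d_pt_comp (fun v => v ^ S k) (fun u v => v)).
        { apply derivable_continuous_pt, derivable_pt_pow. }
        apply continuity_2d_pt_id2.
      * apply (continuity_1d_2d_pt_comp (Derive f) (fun u v => v * u)).
        { apply continuity_pt_filterlim.
          apply (smooth_continuous (Derive f)), smooth_Derive, Hf. }
        apply continuity_2d_pt_mult;
          [apply continuity_2d_pt_id2 | apply continuity_2d_pt_id1].
    + apply filter_forall; intros y.
      apply (ex_RInt_continuous (V := R_CompleteNormedModule)); intros s _.
      now apply hadamard_continuous.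
  - apply RInt_ext; intros s _; apply is_derive_unique, Hd.
Qed.

Lemma smooth_hadamard (k : nat) (f : R -> R) : smooth f -> smooth (hadamard k f).
Proof.
  intros Hf n; revert k f Hf; induction n as [|n IH]; intros k f Hf; [exact I|].
  exists (hadamard (S k) (Derive f)); split.
  - intros x; now apply is_derive_hadamard.
  - now apply IH, smooth_Derive.
Qed.

Lemma hadamard_quotient (f : R -> R) (x : R) :
  smooth f -> f x - f 0 = x * hadamard 0 (Derive f) x.
Proof.
  intros Hf; unfold hadamard.
  rewrite <- (RInt_scal (V := R_CompleteNormedModule)).
  2:{ apply (ex_RInt_continuous (V := R_CompleteNormedModule)); intros s _.
      apply hadamard_continuous, smooth_Derive, Hf. }
  symmetry; apply is_RInt_unique.
  replace (f x - f 0) with (minus (f (1 * x)) (f (0 * x)))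
    by (unfold minus, plus, opp; simpl; rewrite Rmult_1_l, Rmult_0_l; ring).
  apply (is_RInt_derive (V := R_CompleteNormedModule) (fun s => f (s * x))).
  - intros s _.
    assert (ex_derive f (s * x)) by now apply smooth_ex_derive.
    auto_derive; [auto|].
    unfold scal; simpl; unfold mult; simpl; change (fun x0 => f x0) with f; ring.
  - intros s _. apply (continuous_scal_r x (fun s => s ^ 0 * Derive f (s * x))).
    apply hadamard_continuous, smooth_Derive, Hf.
Qed.

(** Hadamard's lemma, after translating [p] to the origin. The integral form of the quotient is
    smooth at [p] too, where the quotient itself is undefined. *)
Lemma smooth_divide (f : R -> R) (p : R) : smooth f -> f p = 0 ->
  exists g, smooth g /\ forall x, f x = (x - p) * g x.
Proof.
  intros Hf H0.
  assert (Hs : smooth (fun x => f (x + p))) by solve_smooth.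
  assert (Hq : smooth (hadamard 0 (Derive (fun x => f (x + p)))))
    by now apply smooth_hadamard, smooth_Derive.
  exists (fun x => hadamard 0 (Derive (fun x => f (x + p))) (x - p)); split.
  - solve_smooth.
  - intros x; rewrite <- (hadamard_quotient _ (x - p) Hs).
    replace (x - p + p) with x by ring; replace (0 + p) with p by ring.
    rewrite H0; ring.
Qed.

(** * Smooth cutoff functions *)

(** In the induction [exp u] splits into two copies of [exp (u / 2)]: one pays for [(u / 2) ^ n],
    the other for the extra factor [u / 2]. *)
Lemma pow_le_exp (n : nat) :
  exists C, 0 < C /\ forall u, 0 <= u -> u ^ n <= C * exp u.
Proof.
  induction n as [|n [C [HC IH]]].
  - exists 1; split; [lra|]; intros u Hu; simpl.
    generalize (exp_ineq1_le u); lra.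
  - exists (2 ^ S n * C); split.
    + apply Rmult_lt_0_compat; [apply pow_lt; lra | exact HC].
    + intros u Hu.
      assert (Hv : 0 <= u / 2) by lra.
      replace (u ^ S n) with (2 ^ S n * ((u / 2) ^ n * (u / 2))).
      2:{ replace ((u / 2) ^ n * (u / 2)) with ((u / 2) ^ S n) by (simpl; ring).
          rewrite <- Rpow_mult_distr; f_equal; field. }
      replace (exp u) with (exp (u / 2) * exp (u / 2))
        by (rewrite <- exp_plus; f_equal; field).
      rewrite Rmult_assoc; apply Rmult_le_compat_l; [apply pow_le; lra|].
      rewrite <- Rmult_assoc; apply Rmult_le_compat.
      * now apply pow_le.
      * exact Hv.
      * now apply IH.
      * generalize (exp_ineq1_le (u / 2)); lra.
Qed.

Lemma is_derive_0_quadratic (f : R -> R) (C : R) :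
  (forall y, Rabs (f y) <= C * y ^ 2) -> is_derive f 0 0.
Proof.
  intros H.
  assert (HC : 0 <= C) by (generalize (H 1) (Rabs_pos (f 1)); lra).
  assert (H0 : f 0 = 0).
  { generalize (H 0); replace (C * 0 ^ 2) with 0 by ring; intros H0.
    destruct (Req_dec (f 0) 0) as [E|E]; auto.
    generalize (Rabs_pos_lt _ E); lra. }
  apply is_derive_Reals; intros eps Heps.
  assert (Hd : 0 < eps / (C + 1)) by (apply Rdiv_lt_0_compat; lra).
  exists (mkposreal _ Hd); simpl; intros h Hh Hlt.
  rewrite H0, Rplus_0_l, !Rminus_0_r.
  unfold Rdiv; rewrite Rabs_mult, Rabs_inv.
  assert (Hp : 0 < Rabs h) by now apply Rabs_pos_lt.
  apply Rle_lt_trans with (C * Rabs h).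
  - apply Rmult_le_reg_r with (Rabs h); [exact Hp|].
    rewrite Rmult_assoc, Rinv_l, Rmult_1_r by lra.
    generalize (H h); rewrite <- (pow2_abs h); simpl; lra.
  - apply Rle_lt_trans with ((C + 1) * Rabs h); [lra|].
    apply Rmult_lt_reg_r with (/ (C + 1)); [apply Rinv_0_lt_compat; lra|].
    replace ((C + 1) * Rabs h * / (C + 1)) with (Rabs h) by (field; lra).
    exact Hlt.
Qed.

(** The classical function flat at 0. The powers of [/ x] are included because derivatives of
    members of the family are linear combinations of members. *)
Definition flat (k : nat) (x : R) : R :=
  if Rlt_dec 0 x then (/ x) ^ k * exp (- / x) else 0.

Lemma flat_pos (k : nat) (x : R) : 0 < x -> flat k x = (/ x) ^ k * exp (- / x).
Proof. intros H; unfold flat; destruct (Rlt_dec 0 x); [reflexivity | lra]. Qed.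

Lemma flat_neg (k : nat) (x : R) : x <= 0 -> flat k x = 0.
Proof. intros H; unfold flat; destruct (Rlt_dec 0 x); [lra | reflexivity]. Qed.

(** With [u = / x] this reads [u ^ (k + 2) <= C * exp u]. It yields the derivative at 0, the only
    point where the two branches meet. *)
Lemma flat_bound (k : nat) : exists C, forall x, Rabs (flat k x) <= C * x ^ 2.
Proof.
  destruct (pow_le_exp (k + 2)) as [C [HC H]].
  exists C; intros x; destruct (Rlt_le_dec 0 x) as [Hx|Hx].
  - rewrite flat_pos by exact Hx.
    assert (Hi : 0 < / x) by now apply Rinv_0_lt_compat.
    rewrite Rabs_pos_eq.
    2:{ apply Rmult_le_pos; [apply pow_le; lra | left; apply exp_pos]. }
    apply Rmult_le_reg_r with (exp (/ x)); [apply exp_pos|].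
    rewrite Rmult_assoc, <- exp_plus, Rplus_opp_l, exp_0, Rmult_1_r.
    apply Rmult_le_reg_r with ((/ x) ^ 2); [now apply pow_lt|].
    rewrite <- pow_add.
    replace (C * x ^ 2 * exp (/ x) * (/ x) ^ 2) with (C * exp (/ x)) by (field; lra).
    apply H; lra.
  - rewrite flat_neg, Rabs_R0 by exact Hx.
    apply Rmult_le_pos; [lra | apply pow2_ge_0].
Qed.

Lemma is_derive_flat (k : nat) (x : R) :
  is_derive (flat k) x (- INR k * flat (S k) x + flat (S (S k)) x).
Proof.
  destruct (Rtotal_order x 0) as [Hx|[->|Hx]].
  - rewrite !flat_neg by lra.
    replace (- INR k * 0 + 0) with 0 by ring.
    apply is_derive_ext_loc with (fun _ => 0); [|apply (is_derive_const 0)].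
    apply filter_imp with (fun y => y < 0); [|now apply open_lt].
    intros y Hy; now rewrite flat_neg by lra.
  - destruct (flat_bound k) as [C HC].
    rewrite !flat_neg by lra.
    replace (- INR k * 0 + 0) with 0 by ring.
    now apply is_derive_0_quadratic with C.
  - rewrite !flat_pos by lra.
    apply is_derive_ext_loc with (fun y => (/ y) ^ k * exp (- / y)).
    + apply filter_imp with (fun y => 0 < y); [|now apply open_gt].
      intros y Hy; now rewrite flat_pos.
    + auto_derive; [repeat split; lra|].
      destruct k as [|k]; [simpl; field; lra|].
      replace (pred (S k)) with k by reflexivity.
      simpl pow; field; lra.
Qed.

Lemma smooth_flat (k : nat) : smooth (flat k).
Proof.
  intros n; revert k; induction n as [|n IH]; intros k; [exact I|].
  exists (fun x => - INR k * flat (S k) x + flat (S (S k)) x); split.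
  - intros x; apply is_derive_flat.
  - apply diffn_plus; [apply diffn_mult; [apply diffn_const|]|]; apply IH.
Qed.

Definition step (x : R) : R := flat 0 x / (flat 0 x + flat 0 (1 - x)).

Lemma flat_ge0 (x : R) : 0 <= flat 0 x.
Proof.
  destruct (Rlt_le_dec 0 x) as [H|H].
  - rewrite flat_pos by exact H; simpl; generalize (exp_pos (- / x)); lra.
  - rewrite flat_neg; lra.
Qed.

Lemma flat_gt0 (x : R) : 0 < x -> 0 < flat 0 x.
Proof.
  intros H; rewrite flat_pos by exact H; simpl; generalize (exp_pos (- / x)); lra.
Qed.

(** [x] and [1 - x] cannot both be nonpositive. *)
Lemma step_denominator (x : R) : 0 < flat 0 x + flat 0 (1 - x).
Proof.
  generalize (flat_ge0 x) (flat_ge0 (1 - x)); intros H1 H2.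
  destruct (Rlt_le_dec 0 x) as [H|H].
  - generalize (flat_gt0 x H); lra.
  - assert (H' : 0 < 1 - x) by lra; generalize (flat_gt0 _ H'); lra.
Qed.

Lemma smooth_step : smooth step.
Proof.
  assert (H := smooth_flat 0).
  unfold step; apply smooth_mult; [exact H|].
  apply smooth_inv.
  - intros x; generalize (step_denominator x); lra.
  - solve_smooth.
Qed.

Lemma step_left (x : R) : x <= 0 -> step x = 0.
Proof. intros H; unfold step; rewrite (flat_neg 0 x H); unfold Rdiv; ring. Qed.

Lemma step_right (x : R) : 1 <= x -> step x = 1.
Proof.
  intros H; unfold step; rewrite (flat_neg 0 (1 - x)) by lra.
  assert (Hx : 0 < x) by lra; generalize (flat_gt0 x Hx); intros; field; lra.
Qed.

Lemma step_between (x : R) : 0 <= step x <= 1.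
Proof.
  unfold step; generalize (step_denominator x) (flat_ge0 x) (flat_ge0 (1 - x)).
  intros H1 H2 H3; split.
  - apply Rdiv_le_0_compat; lra.
  - apply Rmult_le_reg_r with (flat 0 x + flat 0 (1 - x)); [exact H1|].
    unfold Rdiv; rewrite Rmult_assoc, Rinv_l by lra; lra.
Qed.

(** An explicit support radius, instead of compactness of the closed support, makes sums, products
    and cutoffs immediate; [test_Cinfty_c] gives the passage to [Cinfty_c]. *)
Definition test (f : R -> R) : Prop :=
  smooth f /\ exists A, 0 < A /\ forall x, A <= Rabs x -> f x = 0.

Lemma continuous_bounded_support (f : R -> R) (A : R) :
  (forall x, continuous f x) -> (forall x, A <= Rabs x -> f x = 0) ->
  exists M, 0 <= M /\ forall x, Rabs (f x) <= M.
Proof.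
  intros Hc Hz; destruct (Rlt_le_dec A 0) as [HA|HA].
  - exists 0; split; [lra|]; intros x.
    rewrite Hz, Rabs_R0; [lra | generalize (Rabs_pos x); lra].
  - destruct (continuity_ab_maj (fun x => Rabs (f x)) (- A) A) as [m [Hm _]]; [lra| |].
    + intros x _; apply continuity_pt_filterlim.
      apply (continuous_comp f Rabs); [apply Hc | apply continuous_Rabs].
    + exists (Rabs (f m)); split; [apply Rabs_pos|]; intros x.
      destruct (Rle_lt_dec A (Rabs x)) as [H|H].
      * rewrite Hz, Rabs_R0 by exact H; apply Rabs_pos.
      * apply Hm; apply Rabs_def2 in H; lra.
Qed.

Lemma test_bounded (f : R -> R) : test f ->
  exists M, 0 <= M /\ forall x, Rabs (f x) <= M.
Proof.
  intros [Hs [A [_ HA]]]; apply continuous_bounded_support with A; [|exact HA].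
  intros x; now apply smooth_continuous.
Qed.

(** The strict inequality provides a whole neighbourhood of [x] on which [f] is zero, so
    differentiability of [f] need not be assumed. *)
Lemma Derive_outside (f : R -> R) (A x : R) :
  (forall x, A <= Rabs x -> f x = 0) -> A < Rabs x -> Derive f x = 0.
Proof.
  intros Hz Hx; apply is_derive_unique.
  apply is_derive_ext_loc with (fun _ => 0); [|apply (is_derive_const 0)].
  apply filter_imp with (fun y => A < Rabs y).
  - intros y Hy; symmetry; apply Hz; lra.
  - apply (continuous_Rabs x (fun z => A < z)); now apply open_gt.
Qed.

Lemma test_Derive (f : R -> R) : test f -> test (Derive f).
Proof.
  intros [Hs [A [HA Hz]]]; split; [now apply smooth_Derive|].
  exists (A + 1); split; [lra|]; intros x Hx.
  apply Derive_outside with A; [exact Hz | lra].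
Qed.

Lemma test_plus (f g : R -> R) : test f -> test g -> test (fun x => f x + g x).
Proof.
  intros [Hf [A [HA Ha]]] [Hg [B [HB Hb]]]; split; [solve_smooth|].
  exists (Rmax A B); split; [generalize (Rmax_l A B); lra|]; intros x Hx.
  generalize (Rmax_l A B) (Rmax_r A B); intros.
  rewrite Ha, Hb by lra; ring.
Qed.

Lemma test_mult_l (f g : R -> R) : smooth f -> test g -> test (fun x => f x * g x).
Proof.
  intros Hf [Hg [B [HB Hb]]]; split; [solve_smooth|].
  exists B; split; [exact HB|]; intros x Hx; rewrite Hb by exact Hx; ring.
Qed.

Lemma test_scal (c : R) (g : R -> R) : test g -> test (fun x => c * g x).
Proof. apply (test_mult_l (fun _ => c)), smooth_const. Qed.

Lemma test_minus (f g : R -> R) : test f -> test g -> test (fun x => f x - g x).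
Proof.
  intros Hf Hg; replace (fun x => f x - g x) with (fun x => f x + (-1) * g x).
  - apply test_plus; [exact Hf | now apply test_scal].
  - apply functional_extensionality; intros x; ring.
Qed.

Definition bump (x : R) : R := step (x + 2) * step (2 - x).

Lemma bump_in (x : R) : Rabs x <= 1 -> bump x = 1.
Proof.
  intros H; apply Rabs_le_between in H; unfold bump.
  rewrite !step_right by lra; ring.
Qed.

Lemma bump_out (x : R) : 2 <= Rabs x -> bump x = 0.
Proof.
  intros H; unfold bump; destruct (Rle_dec x 0) as [Hx|Hx].
  - rewrite Rabs_left1 in H by lra; rewrite step_left by lra; ring.
  - rewrite Rabs_pos_eq in H by lra; rewrite (step_left (2 - x)) by lra; ring.
Qed.

Lemma bump_between (x : R) : 0 <= bump x <= 1.
Proof.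
  unfold bump; generalize (step_between (x + 2)) (step_between (2 - x)); nra.
Qed.

Lemma test_bump : test bump.
Proof.
  split.
  - assert (H := smooth_step); unfold bump; solve_smooth.
  - exists 2; split; [lra | apply bump_out].
Qed.

Lemma is_derive_bump_scaled (r x : R) :
  is_derive (fun x => bump (x / r)) x (Derive bump (x / r) / r).
Proof.
  assert (ex_derive bump (x / r)) by (apply smooth_ex_derive, test_bump).
  auto_derive; [assumption|].
  change (fun x0 => bump x0) with bump; unfold Rdiv; ring.
Qed.

Lemma Rabs_div_pos (r x : R) : 0 < r -> Rabs (x / r) = Rabs x / r.
Proof.
  intros Hr; unfold Rdiv; rewrite Rabs_mult, (Rabs_pos_eq (/ r)); [reflexivity|].
  left; now apply Rinv_0_lt_compat.
Qed.

Lemma bump_scaled_in (r x : R) : 0 < r -> Rabs x <= r -> bump (x / r) = 1.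
Proof.
  intros Hr Hx; apply bump_in; rewrite Rabs_div_pos by exact Hr.
  apply Rmult_le_reg_r with r; [exact Hr|].
  unfold Rdiv; rewrite Rmult_assoc, Rinv_l; lra.
Qed.

Lemma test_bump_scaled (r : R) : 0 < r -> test (fun x => bump (x / r)).
Proof.
  intros Hr; split.
  - assert (H := proj1 test_bump); solve_smooth.
  - exists (2 * r); split; [lra|]; intros x Hx; apply bump_out.
    rewrite Rabs_div_pos by exact Hr.
    apply Rmult_le_reg_r with r; [exact Hr|].
    unfold Rdiv; rewrite Rmult_assoc, Rinv_l; lra.
Qed.

Lemma C1_0_vanish (f : R -> R) (A : R) :
  Defs.C1 f -> (forall x, A <= Rabs x -> f x = 0) -> C1_0 f.
Proof.
  intros Hf Hz.
  assert (Hlim : forall g : R -> R, (forall x, A < Rabs x -> g x = 0) ->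
                   is_lim g p_infty 0 /\ is_lim g m_infty 0).
  { intros g Hg; split; apply is_lim_ext_loc with (fun _ => 0);
      try apply is_lim_const.
    - exists (Rabs A); intros x Hx; symmetry; apply Hg.
      rewrite (Rabs_pos_eq x); generalize (Rle_abs A) (Rabs_pos A); lra.
    - exists (- Rabs A); intros x Hx; symmetry; apply Hg.
      rewrite (Rabs_left x); generalize (Rle_abs A) (Rabs_pos A); lra. }
  destruct (Hlim f) as [H1 H2]; [intros x Hx; apply Hz; lra|].
  destruct (Hlim (Derive f)) as [H3 H4].
  { intros x Hx; now apply Derive_outside with A. }
  repeat split; auto; apply Hf.
Qed.

Lemma smooth_C1 (f : R -> R) : smooth f -> Defs.C1 f.
Proof.
  intros Hs; split; intros x; [now apply smooth_ex_derive|].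
  now apply smooth_continuous, smooth_Derive.
Qed.

Lemma test_C1_0 (f : R -> R) : test f -> C1_0 f.
Proof.
  intros [Hs [A [_ Hz]]]; apply C1_0_vanish with A; [now apply smooth_C1 | exact Hz].
Qed.

Lemma test_Cinfty_c (f : R -> R) : test f -> Cinfty_c f.
Proof.
  intros [Hs [A [HA Hz]]]; split; [now apply smooth_ex_derive_n|].
  apply compact_carac; split; [apply adherence_P3|].
  exists (- A), A; intros x Hx.
  destruct (Rle_lt_dec (Rabs x) A) as [H|H]; [now apply Rabs_le_between|exfalso].
  destruct (Hx (fun y => A < Rabs y)) as [y [Hy1 Hy2]].
  - assert (Hp : 0 < Rabs x - A) by lra.
    exists (mkposreal _ Hp); intros y Hy; unfold disc in Hy; simpl in Hy.
    generalize (Rabs_triang_inv x (x - y)); rewrite (Rabs_minus_sym x y).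
    replace (x - (x - y)) with y by ring; lra.
  - apply Hy2, Hz; lra.
Qed.

(** * Density of the test functions *)

Lemma mean_value (f f' : R -> R) (a b : R) :
  (forall x, is_derive f x (f' x)) ->
  exists c, Rmin a b <= c <= Rmax a b /\ f b - f a = f' c * (b - a).
Proof.
  intros H; apply MVT_gen.
  - intros x _; apply H.
  - intros x _; apply continuity_pt_filterlim.
    apply (ex_derive_continuous f); eexists; apply H.
Qed.

(** A smooth staircase over a partition finer than the modulus of uniform continuity. On each cell
    its value is a convex combination of the values of [g] at the two ends, both within [eps] of [g]
    on that cell. *)
Lemma step_approximation (g : R -> R) (A eps : R) :
  0 < A -> 0 < eps -> (forall x, continuous g x) ->
  (forall x, A <= Rabs x -> g x = 0) ->
  exists h, smooth h /\ (forall x, A <= Rabs x -> h x = 0) /\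
    forall x, Rabs (h x - g x) <= eps.
Proof.
  intros HA Heps Hc Hz.
  destruct (Heine_cor2 (f := g) (a := - A) (b := A)) with (eps := mkposreal _ Heps)
    as [delta Hdelta].
  { intros x _; apply continuity_pt_filterlim, Hc. }
  simpl in Hdelta.
  destruct (INR_unbounded (2 * A / delta)) as [n Hn].
  assert (Hdpos := cond_pos delta).
  assert (Hn0 : 0 < INR n).
  { apply Rlt_trans with (2 := Hn); apply Rdiv_lt_0_compat; lra. }
  set (d := 2 * A / INR n).
  assert (Hd : 0 < d) by (apply Rdiv_lt_0_compat; lra).
  assert (Hd' : d < delta).
  { unfold d; apply Rmult_lt_reg_r with (INR n / delta).
    - now apply Rdiv_lt_0_compat.
    - replace (2 * A / INR n * (INR n / delta)) with (2 * A / delta) by (field; lra).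
      replace (delta * (INR n / delta)) with (INR n) by (field; lra); exact Hn. }
  assert (HgA : forall x, x <= - A -> g x = 0).
  { intros x Hx; apply Hz; rewrite Rabs_left1; lra. }
  (* Staircase with [j] steps: accurate up to the [j]-th node and constant beyond it, so that the
     next step can be added without disturbing what lies to the left. *)
  assert (Hj : forall j, (j <= n)%nat -> exists h, smooth h /\
    (forall x, x <= - A -> h x = 0) /\
    (forall x, x <= - A + INR j * d -> Rabs (h x - g x) <= eps) /\
    (forall x, - A + INR j * d <= x -> h x = g (- A + INR j * d))).
  { intros j; induction j as [|j IH]; intros Hjn.
    - exists (fun _ => 0); split; [apply smooth_const|].
      simpl INR; rewrite Rmult_0_l, Rplus_0_r.
      repeat split.
      + intros x Hx; rewrite HgA, Rminus_0_r, Rabs_R0 by exact Hx; lra.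
      + intros x _; now rewrite HgA by lra.
    - destruct IH as [h [Hs [Hl [He Hr]]]]; [lia|].
      rewrite S_INR.
      assert (Hb : INR (S j) * d <= 2 * A).
      { apply Rle_trans with (INR n * d).
        - apply Rmult_le_compat_r; [lra | now apply le_INR].
        - unfold d; right; field; lra. }
      rewrite S_INR in Hb.
      assert (H0 : 0 <= INR j * d) by (apply Rmult_le_pos; [apply pos_INR | lra]).
      set (xj := - A + INR j * d) in *.
      replace (- A + (INR j + 1) * d) with (xj + d) by (unfold xj; ring).
      set (D := g (xj + d) - g xj).
      exists (fun x => h x + D * step ((x - xj) / d)).
      assert (Hl0 : forall x, x <= xj -> step ((x - xj) / d) = 0).
      { intros x Hx; apply step_left.
        apply Rmult_le_reg_r with d; [exact Hd|].
        unfold Rdiv; rewrite Rmult_assoc, Rinv_l; lra. }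
      assert (Hr1 : forall x, xj + d <= x -> step ((x - xj) / d) = 1).
      { intros x Hx; apply step_right.
        apply Rmult_le_reg_r with d; [exact Hd|].
        unfold Rdiv; rewrite Rmult_assoc, Rinv_l; lra. }
      repeat split.
      + assert (H := smooth_step); solve_smooth.
      + intros x Hx; rewrite Hl, Hl0 by (unfold xj; lra); ring.
      + intros x Hx; destruct (Rle_lt_dec x xj) as [Hx'|Hx'].
        * rewrite Hl0, Rmult_0_r, Rplus_0_r by exact Hx'; now apply He.
        * rewrite Hr by lra.
          assert (H1 : Rabs (g xj - g x) < eps).
          { apply Hdelta; unfold xj in *; try lra.
            rewrite Rabs_left; lra. }
          assert (H2 : Rabs (g (xj + d) - g x) < eps).
          { apply Hdelta; unfold xj in *; try lra.
            rewrite Rabs_pos_eq; lra. }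
          apply Rabs_def2 in H1; apply Rabs_def2 in H2.
          generalize (step_between ((x - xj) / d)); intros H3.
          apply Rabs_le; unfold D; nra.
      + intros x Hx; rewrite Hr, Hr1 by lra; unfold D; ring. }
  destruct (Hj n (le_n n)) as [h [Hs [Hl [He Hr]]]].
  assert (Hend : - A + INR n * d = A) by (unfold d; field; lra).
  rewrite Hend in *.
  assert (HgA' : forall x, A <= x -> g x = 0).
  { intros x Hx; apply Hz; rewrite Rabs_pos_eq; lra. }
  exists h; repeat split; [exact Hs| |].
  - intros x Hx; destruct (Rle_lt_dec 0 x) as [H|H].
    + rewrite Rabs_pos_eq in Hx by exact H; rewrite Hr by exact Hx; apply HgA'; lra.
    + rewrite Rabs_left in Hx by exact H; apply Hl; lra.
  - intros x; destruct (Rle_lt_dec x A) as [H|H]; [now apply He|].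
    rewrite Hr, !HgA', Rminus_0_r, Rabs_R0 by lra; lra.
Qed.

Lemma step_Derive_bounded : exists S, 0 <= S /\ forall x, Rabs (Derive step x) <= S.
Proof.
  apply continuous_bounded_support with 2.
  - intros x; apply smooth_continuous, smooth_Derive, smooth_step.
  - intros x Hx; apply is_derive_unique; destruct (Rle_lt_dec 0 x) as [H|H].
    + rewrite Rabs_pos_eq in Hx by exact H.
      apply is_derive_ext_loc with (fun _ => 1); [|apply (is_derive_const 1)].
      apply filter_imp with (fun y => 1 < y); [|apply open_gt; lra].
      intros y Hy; rewrite step_right; lra.
    + rewrite Rabs_left in Hx by exact H.
      apply is_derive_ext_loc with (fun _ => 0); [|apply (is_derive_const 0)].
      apply filter_imp with (fun y => y < 0); [|now apply open_lt].
      intros y Hy; rewrite step_left; lra.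
Qed.

(** Approximate the derivative by a smooth [h] and integrate from [- A]. The primitive may end at a
    small constant [kappa] instead of 0; subtracting [kappa] times a smooth step placed after [A]
    restores compact support. *)
Lemma test_dense_compact_support (f : R -> R) (A eps : R) :
  0 < A -> 0 < eps -> Defs.C1 f -> (forall x, A < Rabs x -> f x = 0) ->
  (forall x, A <= Rabs x -> Derive f x = 0) ->
  exists psi, test psi /\ forall x,
    Rabs (f x - psi x) <= eps /\ Rabs (Derive f x - Derive psi x) <= eps.
Proof.
  intros HA Heps [Hd Hc] Hz Hz'.
  destruct step_Derive_bounded as [S [HS HSb]].
  (* The values err by at most [2 * A * e] from the integral plus as much from the correcting step,
     the derivative by [e + 2 * A * e * S]. *)
  set (e := eps / (1 + 4 * A * (1 + S))).
  assert (Hden : 1 <= 1 + 4 * A * (1 + S)) by nra.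
  assert (He : 0 < e) by (apply Rdiv_lt_0_compat; lra).
  assert (Hee : e * (1 + 4 * A * (1 + S)) = eps) by (unfold e; field; lra); clearbody e.
  destruct (step_approximation (Derive f) A e HA He Hc Hz') as [h [Hs [Hh Hhe]]].
  assert (HH : forall x, is_derive (RInt h (- A)) x (h x)).
  { intros x; apply (is_derive_RInt h (RInt h (- A)) (- A) x).
    - apply filter_forall; intros y; apply (RInt_correct (V := R_CompleteNormedModule)).
      apply (ex_RInt_continuous (V := R_CompleteNormedModule)); intros s _.
      now apply smooth_continuous.
    - now apply smooth_continuous. }
  set (D := fun x => RInt h (- A) x - f x).
  assert (HD : forall x, is_derive D x (h x - Derive f x)).
  { intros x; apply (is_derive_minus (RInt h (- A)) f); [apply HH|].
    now apply Derive_correct. }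
  (* The hypothesis on [f] is strict in [A]; since the derivative vanishes from radius [A] on, the
     mean value theorem between [y] and [2 * y] reaches the endpoints. *)
  assert (HfA : f (- A) = 0 /\ f A = 0).
  { assert (Hlim : forall y, Rabs y = A -> f y = 0).
    { intros y Hy.
      destruct (mean_value f (Derive f) y (2 * y)) as [c [Hc1 Hc2]].
      { intros x; now apply Derive_correct. }
      rewrite (Hz (2 * y)) in Hc2.
      2:{ rewrite Rabs_mult, Rabs_pos_eq by lra; lra. }
      rewrite (Hz' c) in Hc2; [lra|].
      unfold Rmin, Rmax in Hc1; unfold Rabs in *.
      destruct (Rcase_abs y), (Rcase_abs c), (Rle_dec y (2 * y)); lra. }
    split; apply Hlim; [rewrite Rabs_left | rewrite Rabs_pos_eq]; lra. }
  assert (HD0 : D (- A) = 0).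
  { unfold D; rewrite RInt_point, (proj1 HfA); unfold zero; simpl; ring. }
  set (kappa := D A).
  assert (Hleft : forall x, x <= - A -> D x = 0).
  { intros x Hx; destruct (mean_value D _ (- A) x HD) as [c [Hc1 Hc2]].
    rewrite Rmin_right, Rmax_left in Hc1 by lra.
    rewrite Hh, Hz' in Hc2 by (rewrite Rabs_left; lra); lra. }
  assert (Hright : forall x, A <= x -> D x = kappa).
  { intros x Hx; destruct (mean_value D _ A x HD) as [c [Hc1 Hc2]].
    rewrite Rmin_left, Rmax_right in Hc1 by lra.
    rewrite Hh, Hz' in Hc2 by (rewrite Rabs_pos_eq; lra); unfold kappa; lra. }
  assert (Hmid : forall x, - A <= x <= A -> Rabs (D x) <= 2 * A * e).
  { intros x Hx; destruct (mean_value D _ (- A) x HD) as [c [Hc1 Hc2]].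
    rewrite HD0, Rminus_0_r in Hc2; rewrite Hc2, Rabs_mult, (Rabs_pos_eq (x - - A)) by lra.
    generalize (Hhe c) (Rabs_pos (h c - Derive f c)); nra. }
  assert (Hk : Rabs kappa <= 2 * A * e) by (apply Hmid; lra).
  assert (HDb : forall x, Rabs (D x) <= 2 * A * e).
  { intros x; destruct (Rle_lt_dec x (- A)) as [H|H].
    - rewrite Hleft, Rabs_R0 by exact H; generalize (Rabs_pos kappa); lra.
    - destruct (Rle_lt_dec x A) as [H'|H']; [apply Hmid; lra|].
      now rewrite Hright by lra. }
  assert (Hpsi : forall x, is_derive
      (fun x : R => RInt h (- A) x - kappa * step (x - A)) x
      (h x - kappa * Derive step (x - A))).
  { intros x; apply (is_derive_minus (RInt h (- A))); [apply HH|].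
    assert (ex_derive step (x - A)) by apply smooth_ex_derive, smooth_step.
    auto_derive; [assumption|]; change (fun x0 => step x0) with step; unfold Rminus; ring. }
  exists (fun x => RInt h (- A) x - kappa * step (x - A)); split; [split|].
  - apply smooth_intro with (1 := Hpsi).
    assert (H := smooth_step); solve_smooth.
  - exists (A + 1); split; [lra|]; intros x Hx.
    replace (RInt h (- A) x) with (D x + f x) by (unfold D; ring).
    rewrite Hz by lra.
    destruct (Rle_lt_dec 0 x) as [H|H].
    + rewrite Rabs_pos_eq in Hx by exact H.
      rewrite Hright, step_right by lra; ring.
    + rewrite Rabs_left in Hx by exact H.
      rewrite Hleft, step_left by lra; ring.
  - intros x; split.
    + replace (f x - (RInt h (- A) x - kappa * step (x - A)))
        with (- D x + kappa * step (x - A)) by (unfold D; ring).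
      apply Rle_trans with (1 := Rabs_triang _ _).
      rewrite Rabs_Ropp, Rabs_mult.
      generalize (step_between (x - A)) (HDb x) (Rabs_pos kappa); intros H1 H2 H3.
      rewrite (Rabs_pos_eq (step (x - A))) by lra.
      assert (Rabs kappa * step (x - A) <= Rabs kappa * 1)
        by (apply Rmult_le_compat_l; lra).
      assert (0 <= A * e * S) by (repeat apply Rmult_le_pos; lra).
      nra.
    + rewrite (is_derive_unique (fun x : R => RInt h (- A) x - kappa * step (x - A)) x _ (Hpsi x)).
      replace (Derive f x - (h x - kappa * Derive step (x - A)))
        with (- (h x - Derive f x) + kappa * Derive step (x - A)) by ring.
      apply Rle_trans with (1 := Rabs_triang _ _).
      rewrite Rabs_Ropp, Rabs_mult.
      assert (Rabs kappa * Rabs (Derive step (x - A)) <= 2 * A * e * S)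
        by (apply Rmult_le_compat; auto using Rabs_pos).
      assert (0 <= A * e * S) by (repeat apply Rmult_le_pos; lra).
      assert (0 <= A * e) by (apply Rmult_le_pos; lra).
      generalize (Hhe x); nra.
Qed.

Lemma is_lim_small (f : R -> R) (eps : R) :
  is_lim f p_infty 0 -> is_lim f m_infty 0 -> 0 < eps ->
  exists r, 0 < r /\ forall x, r <= Rabs x -> Rabs (f x) <= eps.
Proof.
  intros Hp Hm He.
  apply is_lim_spec in Hp; apply is_lim_spec in Hm.
  destruct (Hp (mkposreal _ He)) as [M1 H1].
  destruct (Hm (mkposreal _ He)) as [M2 H2]; simpl in *.
  generalize (Rle_abs M1) (Rle_abs (- M2)) (Rabs_pos M1) (Rabs_pos M2);
    rewrite Rabs_Ropp; intros.
  exists (Rabs M1 + Rabs M2 + 1); split; [lra|]; intros x Hx.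
  destruct (Rle_lt_dec 0 x) as [H'|H'].
  - rewrite (Rabs_pos_eq x) in Hx by exact H'.
    generalize (H1 x ltac:(lra)); rewrite Rminus_0_r; lra.
  - rewrite (Rabs_left x) in Hx by exact H'.
    generalize (H2 x ltac:(lra)); rewrite Rminus_0_r; lra.
Qed.

(** Multiplying by a wide [bump] changes [f] only where [f] and its derivative are already below
    [e]; the compactly supported case then applies with half the tolerance. *)
Lemma test_dense (f : R -> R) (eps : R) :
  C1_0 f -> 0 < eps ->
  exists psi, test psi /\ forall x,
    Rabs (f x - psi x) <= eps /\ Rabs (Derive f x - Derive psi x) <= eps.
Proof.
  intros [[Hd Hc] [L1 [L2 [L3 L4]]]] Heps.
  destruct (test_bounded _ (test_Derive _ test_bump)) as [S [HS HSb]].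
  set (e := eps / (2 * (1 + S))).
  assert (He : 0 < e) by (apply Rdiv_lt_0_compat; lra).
  assert (Hee : e * (1 + S) = eps / 2) by (unfold e; field; lra); clearbody e.
  destruct (is_lim_small f e L1 L2 He) as [r1 [Hr1 H1]].
  destruct (is_lim_small _ e L3 L4 He) as [r2 [Hr2 H2]].
  (* The added 1 gives [1 <= r], so the derivative of the rescaled [bump] keeps the bound [S]. *)
  set (r := r1 + r2 + 1).
  set (g := fun x => f x * bump (x / r)).
  assert (Hg : forall x, is_derive g x
             (Derive f x * bump (x / r) + f x * (Derive bump (x / r) / r))).
  { intros x; apply (is_derive_mult f (fun x => bump (x / r))).
    - now apply Derive_correct.
    - apply is_derive_bump_scaled.
    - apply Rmult_comm. }
  assert (Hgz : forall x, 2 * r <= Rabs x -> g x = 0).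
  { intros x Hx; unfold g; rewrite bump_out; [ring|].
    rewrite Rabs_div_pos by (unfold r; lra).
    apply Rmult_le_reg_r with r; [unfold r; lra|].
    unfold Rdiv; rewrite Rmult_assoc, Rinv_l; unfold r in *; lra. }
  (* Beyond the support radius [2 * r] one more unit makes [Derive_outside] available at the closed
     bound as well. *)
  destruct (test_dense_compact_support g (2 * r + 1) (eps / 2)) as [psi [Ht Hpsi]].
  - unfold r; lra.
  - lra.
  - split; [intros x; eexists; apply Hg|]; intros x.
    apply continuous_ext with
      (fun x => Derive f x * bump (x / r) + f x * (Derive bump (x / r) / r)).
    { intros y; symmetry; apply is_derive_unique, Hg. }
    assert (Hbs : smooth bump) by apply test_bump.
    assert (smooth (fun x => bump (x / r))) by solve_smooth.
    assert (smooth (fun x => Derive bump (x / r) / r)) by solve_smooth.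
    apply (continuous_plus (V := R_NormedModule));
      apply (continuous_mult (K := R_AbsRing)); try (now apply Hc);
      try now apply smooth_continuous.
    apply (ex_derive_continuous f), Hd.
  - intros x Hx; apply Hgz; lra.
  - intros x Hx; apply Derive_outside with (2 * r); [exact Hgz | lra].
  - exists psi; split; [exact Ht|]; intros x.
    assert (Hfg : Rabs (f x - g x) <= e * (1 + S) /\
                  Rabs (Derive f x - Derive g x) <= e * (1 + S)).
    { destruct (Rlt_le_dec (Rabs x) r) as [Hx|Hx].
      - assert (Hloc : locally x (fun y => f y = g y)).
        { apply filter_imp with (fun y => Rabs y < r).
          - intros y Hy; unfold g; rewrite bump_scaled_in; unfold r in *; lra.
          - apply (continuous_Rabs x (fun z => z < r)); now apply open_lt. }
        rewrite (Derive_ext_loc _ _ _ Hloc), (locally_singleton _ _ Hloc).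
        rewrite !Rminus_eq_0, Rabs_R0; split; nra.
      - rewrite (is_derive_unique _ _ _ (Hg x)); unfold g.
        generalize (bump_between (x / r)) (H1 x ltac:(unfold r in *; lra))
          (H2 x ltac:(unfold r in *; lra)) (Rabs_pos (f x)) (Rabs_pos (Derive f x)).
        intros Hb Hf1 Hf2 Hp1 Hp2.
        split.
        + replace (f x - f x * bump (x / r)) with (f x * (1 - bump (x / r))) by ring.
          rewrite Rabs_mult, (Rabs_pos_eq (1 - _)) by lra; nra.
        + replace (Derive f x - (Derive f x * bump (x / r) + f x * (Derive bump (x / r) / r)))
            with (Derive f x * (1 - bump (x / r)) + - (f x * (Derive bump (x / r) / r))) by ring.
          apply Rle_trans with (1 := Rabs_triang _ _).
          rewrite Rabs_Ropp, !Rabs_mult, (Rabs_pos_eq (1 - _)) by lra.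
          rewrite Rabs_div_pos by (unfold r; lra).
          assert (Hq : Rabs (Derive bump (x / r)) / r <= S).
          { apply Rmult_le_reg_r with r; [unfold r; lra|].
            unfold Rdiv; rewrite Rmult_assoc, Rinv_l by (unfold r; lra).
            generalize (HSb (x / r)); unfold r; nra. }
          assert (Rabs (f x) * (Rabs (Derive bump (x / r)) / r) <= e * S).
          { apply Rmult_le_compat; auto.
            apply Rdiv_le_0_compat; [apply Rabs_pos | unfold r; lra]. }
          nra. }
    destruct (Hpsi x) as [Hp1 Hp2]; destruct Hfg as [Hf1 Hf2]; split.
    + replace (f x - psi x) with ((f x - g x) + (g x - psi x)) by ring.
      apply Rle_trans with (1 := Rabs_triang _ _); lra.
    + replace (Derive f x - Derive psi x)
        with ((Derive f x - Derive g x) + (Derive g x - Derive psi x)) by ring.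
      apply Rle_trans with (1 := Rabs_triang _ _); lra.
Qed.

(** * The linear part of an admissible extension *)

Lemma im_le_Cmod (z : C) : Rabs (Im z) <= Cmod z.
Proof. apply Rle_trans with (2 := Rmax_Cmod z), Rmax_r. Qed.

Lemma sup_norm_le (f : R -> R) (k : R) :
  (forall x, Rabs (f x) <= k) -> 0 <= sup_norm f <= k.
Proof.
  intros H; unfold sup_norm.
  destruct (Lub_Rbar_correct (fun r => exists x, r = Rabs (f x))) as [H1 H2].
  assert (Hk := H2 (Finite k) ltac:(intros r [x ->]; apply H)).
  assert (H0 := H1 _ (ex_intro _ 0 eq_refl)).
  destruct (Lub_Rbar _) as [r| |]; simpl in *; try easy.
  generalize (Rabs_pos (f 0)); lra.
Qed.

Lemma bounded_linear_bound (L : (R -> R) -> C) : bounded_linear_C1_0 L ->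
  exists M, 0 <= M /\ forall f d, C1_0 f ->
    (forall x, Rabs (f x) <= d) -> (forall x, Rabs (Derive f x) <= d) ->
    Cmod (L f) <= M * d.
Proof.
  intros [_ _ [M HM]]; exists (2 * Rabs M); split; [generalize (Rabs_pos M); lra|].
  intros f d Hf H1 H2.
  apply Rle_trans with (1 := HM f Hf); unfold norm_1_infty.
  apply sup_norm_le in H1; apply sup_norm_le in H2.
  generalize (Rle_abs M) (Rabs_pos M); nra.
Qed.

(** The hypothesis on the remainder with the supremum norm replaced by any slope bound [k], so that
    later estimates never compute a supremum. *)
Definition quadratically_tangent (E : (R -> R) -> C -> C) (z0 : C)
    (L : (R -> R) -> C) : Prop :=
  forall c, 0 < c -> exists eps, 0 < eps /\
  forall f k, test f -> k < eps -> (forall x, Rabs (Derive f x) <= k) ->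
  Cmod (E (fun x => x + f x)%R z0 - (z0 + L f))%C <= c * k ^ 2.

Lemma expansion_quadratically_tangent (E : (R -> R) -> C -> C) (z0 : C) (eps0 : R)
    (L Rem : (R -> R) -> C) :
  (forall phi, B_infty eps0 phi ->
     E (fun x => x + phi x) z0 = (z0 + L phi + Rem phi)%C) ->
  (forall c, 0 < c ->
     exists eps, 0 < eps < eps0 /\
     forall phi, B_infty eps phi ->
       Cmod (Rem phi) <= c * (sup_norm (Derive phi)) ^ 2) ->
  quadratically_tangent E z0 L.
Proof.
  intros HE HR c Hc; destruct (HR c Hc) as [eps [Heps Hb]].
  exists eps; split; [lra|]; intros f k Hf Hk Hd.
  apply sup_norm_le in Hd; apply test_Cinfty_c in Hf.
  rewrite HE by (split; [exact Hf | lra]).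
  replace (z0 + L f + Rem f - (z0 + L f))%C with (Rem f) by ring.
  apply Rle_trans with (1 := Hb f ltac:(split; [exact Hf | lra])).
  apply Rmult_le_compat_l; [lra|]; apply pow_incr; lra.
Qed.

Lemma BLplus_near_id (f : R -> R) : Defs.C1 f ->
  (forall x, Rabs (Derive f x) <= 1 / 2) ->
  BLplus (fun x => x + f x) /\ derive_between (1 / 2) (3 / 2) (fun x => x + f x).
Proof.
  intros [Hd Hc] Hb.
  assert (HD : forall x, is_derive (fun y : R => y + f y) x (1 + Derive f x)).
  { intros x; apply (is_derive_plus (fun x => x) f).
    - apply (is_derive_id x).
    - now apply Derive_correct. }
  assert (Hbt : derive_between (1 / 2) (3 / 2) (fun x => x + f x)).
  { intros x; rewrite (is_derive_unique _ _ _ (HD x)).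
    generalize (Hb x); intros H; apply Rabs_le_between in H; lra. }
  split; [|exact Hbt]; split; [split|exists (1 / 2), (3 / 2); split; [lra|split; [lra|exact Hbt]]].
  - intros x; eexists; apply HD.
  - intros x; apply continuous_ext with (fun x => 1 + Derive f x).
    { intros y; symmetry; apply is_derive_unique, HD. }
    apply (continuous_plus (V := R_NormedModule) (fun _ => 1));
      [apply continuous_const | apply Hc].
Qed.

(** * Values of the linear part on truncated affine maps *)

Lemma is_derive_affine (a b x : R) : is_derive (fun y : R => a * y + b) x a.
Proof. auto_derive; [exact I | ring]. Qed.

Lemma BLplus_affine (a b : R) : 0 < a -> BLplus (fun x => a * x + b).
Proof.
  intros Ha; split; [apply (smooth_C1 (fun x => a * x + b)); solve_smooth|].
  exists a, a; split; [exact Ha|split; [exact Ha|]]; intros x.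
  rewrite (is_derive_unique _ _ _ (is_derive_affine a b x)); lra.
Qed.

(** Balls of the product structure on [C] bound the two coordinates separately; halving the radius
    passes to the modulus. *)
Lemma filterlim_Cmod (u : nat -> C) (l : C) (eps : R) :
  filterlim u eventually (locally l) -> 0 < eps ->
  exists N, forall n, (N <= n)%nat -> Cmod (u n - l)%C < eps.
Proof.
  intros H He.
  assert (He2 : 0 < eps / 2) by lra.
  destruct (H _ (locally_ball l (mkposreal _ He2))) as [N HN].
  exists N; intros n Hn; destruct (HN n Hn) as [H1 H2].
  replace (u n - l)%C with (RtoC (Re (u n - l)) + RtoC (Im (u n - l)) * Ci)%C.
  2:{ apply injective_projections; simpl; ring. }
  apply Rle_lt_trans with (1 := Cmod_triangle _ _).
  rewrite Cmod_mult, Cmod_Ci, !Cmod_R.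
  unfold ball, AbsRing_ball, abs, minus, plus, opp in H1, H2; simpl in H1, H2.
  unfold ball, AbsRing_ball, abs, minus, plus, opp in H1, H2; simpl in H1, H2.
  unfold Re, Im; simpl; lra.
Qed.

Definition affine_cutoff (alpha beta : R) (n : nat) (x : R) : R :=
  (alpha * x + beta) * bump (x / (INR n + 1)).

Lemma INR_1_pos (n : nat) : 1 <= INR n + 1.
Proof. generalize (pos_INR n); lra. Qed.

Lemma test_affine_cutoff (alpha beta : R) (n : nat) :
  test (affine_cutoff alpha beta n).
Proof.
  unfold affine_cutoff; apply (test_mult_l (fun x => alpha * x + beta)).
  - solve_smooth.
  - apply test_bump_scaled; generalize (INR_1_pos n); lra.
Qed.

Lemma affine_cutoff_in (alpha beta : R) (n : nat) (x : R) :
  Rabs x <= INR n + 1 -> affine_cutoff alpha beta n x = alpha * x + beta.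
Proof.
  intros H; unfold affine_cutoff; rewrite bump_scaled_in; [ring| |exact H].
  generalize (INR_1_pos n); lra.
Qed.

Lemma Derive_affine_cutoff_in (alpha beta : R) (n : nat) (x : R) :
  Rabs x < INR n + 1 -> Derive (affine_cutoff alpha beta n) x = alpha.
Proof.
  intros H; apply is_derive_unique.
  apply is_derive_ext_loc with (fun x => alpha * x + beta); [|apply is_derive_affine].
  apply filter_imp with (fun y => Rabs y < INR n + 1).
  - intros y Hy; symmetry; apply affine_cutoff_in; lra.
  - apply (continuous_Rabs x (fun z => z < INR n + 1)); now apply open_lt.
Qed.

(* The slope is bounded in [n] because [x * Derive bump x] is bounded. *)
Lemma affine_cutoff_slope (alpha beta : R) :
  exists K, 0 <= K /\ forall n x, Rabs (Derive (affine_cutoff alpha beta n) x) <= K.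
Proof.
  assert (Hb := test_Derive _ test_bump).
  destruct (test_bounded _ Hb) as [S [HS HSb]].
  destruct (test_bounded _ (test_mult_l _ _ smooth_id Hb)) as [T [HT HTb]].
  exists (Rabs alpha + (Rabs alpha * T + Rabs beta * S)).
  generalize (Rabs_pos alpha) (Rabs_pos beta); intros Ha0 Hb0; split; [nra|].
  intros n x; set (r := INR n + 1).
  assert (Hr : 1 <= r) by apply INR_1_pos.
  assert (Hd : is_derive (affine_cutoff alpha beta n) x
    (alpha * bump (x / r) + (alpha * x + beta) * (Derive bump (x / r) / r))).
  { apply (is_derive_mult (fun x => alpha * x + beta) (fun x => bump (x / r))).
    - apply is_derive_affine.
    - apply is_derive_bump_scaled.
    - apply Rmult_comm. }
  rewrite (is_derive_unique _ _ _ Hd).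
  replace (alpha * bump (x / r) + (alpha * x + beta) * (Derive bump (x / r) / r))
    with (alpha * bump (x / r) + (alpha * (x / r * Derive bump (x / r)) +
            beta * (Derive bump (x / r) * / r))) by (field; lra).
  apply Rle_trans with (1 := Rabs_triang _ _); apply Rplus_le_compat.
  - rewrite Rabs_mult, (Rabs_pos_eq (bump _)) by apply bump_between.
    generalize (bump_between (x / r)); nra.
  - apply Rle_trans with (1 := Rabs_triang _ _); apply Rplus_le_compat.
    + rewrite (Rabs_mult alpha); apply Rmult_le_compat_l; [exact Ha0 | apply HTb].
    + rewrite (Rabs_mult beta); apply Rmult_le_compat_l; [exact Hb0|].
      rewrite Rabs_mult, (Rabs_pos_eq (/ r)).
      2:{ left; apply Rinv_0_lt_compat; lra. }
      rewrite <- (Rmult_1_r S); apply Rmult_le_compat; auto using Rabs_pos.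
      * left; apply Rinv_0_lt_compat; lra.
      * rewrite <- Rinv_1; apply Rinv_le_contravar; lra.
Qed.

(** For fixed [t], continuity of [E] sends the value at [Id + t * eta n] to that of the affine
    limit, namely [z0 + t * (alpha * z0 + beta)]. Tangency equates the former with
    [z0 + t * L (eta n)] up to [(t * K) ^ 2]. Dividing by [t] leaves an error [t * K ^ 2], made
    small by the choice of [t] before [n]. *)
Lemma affine_cutoff_limit (E : (R -> R) -> C -> C) (z0 : C) (L : (R -> R) -> C)
    (alpha beta : R) :
  admissible_extension E -> upper_half_plane z0 -> bounded_linear_C1_0 L ->
  quadratically_tangent E z0 L ->
  forall eps, 0 < eps -> exists N, forall n, (N <= n)%nat ->
  Cmod (L (affine_cutoff alpha beta n) - (alpha * z0 + beta))%C < eps.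
Proof.
  intros HE Hz HL HT eps Heps.
  destruct (affine_cutoff_slope alpha beta) as [K [HK HKb]].
  destruct (HT 1 Rlt_0_1) as [e [He Htan]].
  (* The three bounds serve membership in [BLplus], the range of the tangency estimate, and the
     quadratic error; [(K + 1) * (K + 1)] dominates both [K] and [K * K]. *)
  set (t := Rmin (Rmin (1 / 2) (e / 2)) (eps / 2) / ((K + 1) * (K + 1))).
  assert (HK1 : 1 <= (K + 1) * (K + 1)) by nra.
  assert (Ht : 0 < t).
  { apply Rdiv_lt_0_compat; [|lra].
    repeat apply Rmin_glb_lt; lra. }
  assert (HtK : t * ((K + 1) * (K + 1)) = Rmin (Rmin (1 / 2) (e / 2)) (eps / 2))
    by (unfold t; field; lra).
  clearbody t.
  assert (Hm1 : t * ((K + 1) * (K + 1)) <= 1 / 2).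
  { rewrite HtK; apply Rle_trans with (1 := Rmin_l _ _), Rmin_l. }
  assert (Hm2 : t * ((K + 1) * (K + 1)) <= e / 2).
  { rewrite HtK; apply Rle_trans with (1 := Rmin_l _ _), Rmin_r. }
  assert (Hm3 : t * ((K + 1) * (K + 1)) <= eps / 2) by (rewrite HtK; apply Rmin_r).
  assert (HtK1 : t * K <= t * ((K + 1) * (K + 1))) by (apply Rmult_le_compat_l; nra).
  set (eta := affine_cutoff alpha beta) in *.
  assert (Heta : forall n, test (eta n)) by (intros n; apply test_affine_cutoff).
  assert (HDt : forall n x, Derive (fun x => t * eta n x) x = t * Derive (eta n) x).
  { intros n x; apply Derive_scal. }
  assert (Hbt : forall n x, Rabs (Derive (fun x => t * eta n x) x) <= t * K).
  { intros n x; rewrite HDt, Rabs_mult, (Rabs_pos_eq t) by lra.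
    apply Rmult_le_compat_l; [lra | apply HKb]. }
  assert (Hnear : forall n, BLplus (fun x => x + t * eta n x) /\
            derive_between (1 / 2) (3 / 2) (fun x => x + t * eta n x)).
  { intros n; apply (BLplus_near_id (fun x => t * eta n x)).
    - apply smooth_C1, test_scal, Heta.
    - intros x; apply Rle_trans with (1 := Hbt n x); lra. }
  (* [alpha] is the slope of every cutoff at 0; this keeps the slope [1 + t * alpha] of the limit
     positive. *)
  assert (Hal : Rabs alpha <= K).
  { rewrite <- (Derive_affine_cutoff_in alpha beta 0 0); [apply HKb|].
    rewrite Rabs_R0; simpl; lra. }
  assert (Hpos : 0 < 1 + t * alpha).
  { apply Rabs_le_between in Hal.
    assert (t * (- K) <= t * alpha) by (apply Rmult_le_compat_l; lra); lra. }
  assert (Hcv : BLplus_cv (fun n x => x + t * eta n x)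
                          (fun x => (1 + t * alpha) * x + t * beta)).
  { assert (Hlarge : forall (K : R -> Prop), compact K -> exists N, forall n,
              (N <= n)%nat -> forall x, K x -> Rabs x < INR n + 1).
    { intros X HX; destruct (compact_P1 X HX) as [m [M HmM]].
      destruct (INR_unbounded (Rabs m + Rabs M)) as [N HN].
      exists N; intros n Hn x Hx; apply le_INR in Hn.
      generalize (HmM x Hx) (Rle_abs M) (Rle_abs (- m)) (Rabs_pos m) (Rabs_pos M).
      rewrite Rabs_Ropp; intros; apply Rabs_def1; lra. }
    split; [|split].
    - intros X HX d Hd; destruct (Hlarge X HX) as [N HN].
      exists N; intros n Hn x Hx; unfold eta.
      rewrite affine_cutoff_in by (left; now apply HN).
      replace (_ - _) with 0 by ring; now rewrite Rabs_R0.
    - intros X HX d Hd; destruct (Hlarge X HX) as [N HN].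
      exists N; intros n Hn x Hx.
      rewrite (is_derive_unique _ _ _ (is_derive_affine _ _ _)).
      rewrite (Derive_plus (fun x => x)), Derive_id, HDt.
      + unfold eta; rewrite Derive_affine_cutoff_in by now apply HN.
        replace (_ - _) with 0 by ring; now rewrite Rabs_R0.
      + apply ex_derive_id.
      + apply smooth_ex_derive, test_scal, Heta.
    - exists (1 / 2), (3 / 2); split; [lra|split; [lra|apply Hnear]]. }
  assert (Hlim := adm_cv E HE _ _ (fun n => proj1 (Hnear n))
                    (BLplus_affine _ _ Hpos) Hcv z0 Hz).
  destruct (filterlim_Cmod _ _ (t * (eps / 2)) Hlim) as [N HN].
  { apply Rmult_lt_0_compat; lra. }
  exists N; intros n Hn; specialize (HN n Hn).
  rewrite (adm_affine E HE _ _ Hpos z0 Hz) in HN.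
  assert (Hq := Htan (fun x => t * eta n x) (t * K) (test_scal _ _ (Heta n))
                 ltac:(lra) (Hbt n)).
  rewrite (bl_scal L HL) in Hq by apply test_C1_0, Heta.
  apply Rmult_lt_reg_l with t; [exact Ht|].
  rewrite <- (Rabs_pos_eq t) at 1 by lra.
  rewrite <- Cmod_R, <- Cmod_mult.
  replace (t * (L (eta n) - (alpha * z0 + beta)))%C with
    (- (E (fun x => x + t * eta n x)%R z0 - (z0 + t * L (eta n))) +
     (E (fun x => x + t * eta n x)%R z0 - ((1 + t * alpha)%R * z0 + (t * beta)%R)))%C.
  2:{ rewrite RtoC_plus, !RtoC_mult; ring. }
  apply Rle_lt_trans with (1 := Cmod_triangle _ _); rewrite Cmod_opp.
  assert (1 * (t * K) ^ 2 <= t * (eps / 2)).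
  { replace (1 * (t * K) ^ 2) with (t * (t * (K * K))) by ring.
    apply Rmult_le_compat_l; [lra|].
    apply Rle_trans with (2 := Hm3), Rmult_le_compat_l; nra. }
  replace (t * eps) with (t * (eps / 2) + t * (eps / 2)) by field; lra.
Qed.

(** * Second-order expansions of compositions and the product rule *)

Lemma test_taylor (f : R -> R) : test f ->
  exists K, 0 <= K /\ forall x h d, 0 <= d <= 1 / 2 -> Rabs h <= d * (1 + Rabs x) ->
    Rabs (f (x + h) - f x) <= K * d /\
    Rabs (f (x + h) - f x - h * Derive f x) <= K * d ^ 2.
Proof.
  intros Hf.
  destruct (test_bounded _ (test_Derive _ Hf)) as [M1 [HM1 HM1b]].
  destruct (test_bounded _ (test_Derive _ (test_Derive _ Hf))) as [M2 [HM2 HM2b]].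
  destruct Hf as [Hs [A [HA Hz]]].
  set (B := 2 * A + 2).
  exists (B * M1 + B * B * M2).
  assert (HB : 0 < B) by (unfold B; lra).
  assert (H1 : 0 <= B * M1) by (apply Rmult_le_pos; lra).
  assert (H2 : 0 <= B * B * M2) by (apply Rmult_le_pos; nra).
  split; [lra|]; intros x h d Hd Hh.
  assert (Hd2 : 0 <= d ^ 2) by apply pow2_ge_0.
  (* The shift [h] may grow linearly, as affine perturbations do. From this radius on [Rabs (x + h)]
     is still at least [A], so every term vanishes; below it [Rabs h <= d * B]. *)
  destruct (Rle_lt_dec (2 * A + 1) (Rabs x)) as [Hx|Hx].
  - rewrite (Hz x), (Derive_outside f A x Hz), Hz by
      (try (generalize (Rabs_triang_inv x (- h)); rewrite Rabs_Ropp;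
            replace (x - - h) with (x + h) by ring); nra).
    replace (0 - 0 - h * 0) with 0 by ring; rewrite Rminus_0_r, Rabs_R0; split; nra.
  - assert (HhB : Rabs h <= d * B).
    { apply Rle_trans with (1 := Hh), Rmult_le_compat_l; unfold B; lra. }
    assert (Hh0 := Rabs_pos h).
    destruct (mean_value f (Derive f) x (x + h)) as [c [Hc1 Hc2]].
    { intros y; now apply smooth_is_derive. }
    destruct (mean_value (Derive f) (Derive (Derive f)) x c) as [c' [_ Hc']].
    { intros y; now apply smooth_is_derive, smooth_Derive. }
    replace (x + h - x) with h in Hc2 by ring.
    assert (Hcx : Rabs (c - x) <= Rabs h).
    { revert Hc1; unfold Rmin, Rmax, Rabs.
      destruct (Rle_dec x (x + h)), (Rcase_abs (c - x)), (Rcase_abs h); lra. }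
    rewrite Hc2; split.
    + rewrite Rabs_mult.
      assert (Rabs (Derive f c) * Rabs h <= M1 * (d * B))
        by (apply Rmult_le_compat; auto using Rabs_pos).
      nra.
    + replace (Derive f c * h - h * Derive f x) with (h * (Derive f c - Derive f x)) by ring.
      rewrite Hc', !Rabs_mult.
      assert (Rabs (Derive (Derive f) c') * Rabs (c - x) <= M2 * (d * B)).
      { apply Rmult_le_compat; auto using Rabs_pos; lra. }
      assert (Rabs h * (Rabs (Derive (Derive f) c') * Rabs (c - x)) <=
              d * B * (M2 * (d * B))).
      { apply Rmult_le_compat; auto.
        apply Rmult_le_pos; apply Rabs_pos. }
      replace (d * B * (M2 * (d * B))) with (B * B * M2 * d ^ 2) in * by ring.
      assert (0 <= B * M1 * d ^ 2) by (apply Rmult_le_pos; lra); lra.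
Qed.

Lemma test_perturbed (f eta : R -> R) (d : R) : test f -> smooth eta ->
  0 <= d <= 1 / 2 -> (forall x, Rabs (eta x) <= d * (1 + Rabs x)) ->
  test (fun x => f (x + eta x)).
Proof.
  intros [Hs [A [HA Hz]]] He Hd Hb; split; [solve_smooth|].
  exists (2 * A + 1); split; [lra|]; intros x Hx; apply Hz.
  generalize (Rabs_triang_inv x (- eta x)) (Hb x); rewrite Rabs_Ropp.
  replace (x - - eta x) with (x + eta x) by ring; nra.
Qed.

Lemma bl_minus_test (L : (R -> R) -> C) (f g : R -> R) : bounded_linear_C1_0 L ->
  test f -> test g -> L (fun x => f x - g x) = (L f - L g)%C.
Proof.
  intros HL Hf Hg.
  replace (fun x => f x - g x) with (fun x => f x + (-1) * g x).
  - rewrite (bl_plus L HL f (fun x => (-1) * g x)), (bl_scal L HL).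
    + change (-1) with (- (1)); rewrite RtoC_opp; ring.
    + now apply test_C1_0.
    + now apply test_C1_0.
    + now apply test_C1_0, test_scal.
  - apply functional_extensionality; intros x; ring.
Qed.

(** [L] is bounded only in the [C1] norm, so both the Taylor remainder and its derivative must be of
    order [d ^ 2]; this is why the slope of [eta] is controlled too. *)
Lemma perturbed_expansion (L : (R -> R) -> C) (f : R -> R) :
  bounded_linear_C1_0 L -> test f ->
  exists K, 0 <= K /\ forall eta d, smooth eta -> 0 <= d <= 1 / 2 ->
    (forall x, Rabs (eta x) <= d * (1 + Rabs x)) ->
    (forall x, Rabs (Derive eta x) <= d) ->
    Cmod (L (fun x => f (x + eta x)%R) - (L f + L (fun x => eta x * Derive f x)%R))%C
      <= K * d ^ 2.
Proof.
  intros HL Hf.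
  destruct (bounded_linear_bound L HL) as [M [HM HMb]].
  destruct (test_taylor f Hf) as [K1 [HK1 HT1]].
  destruct (test_taylor _ (test_Derive f Hf)) as [K2 [HK2 HT2]].
  exists (M * (K1 + 2 * K2)); split; [nra|]; intros eta d He Hd Hb Hb'.
  assert (Ht := test_perturbed f eta d Hf He Hd Hb).
  assert (Ht' := test_mult_l eta _ He (test_Derive f Hf)).
  replace (L (fun x => f (x + eta x)%R) - (L f + L (fun x => eta x * Derive f x)%R))%C
    with (L (fun x => f (x + eta x) - f x - eta x * Derive f x)).
  2:{ rewrite (bl_minus_test L (fun x => f (x + eta x) - f x)), (bl_minus_test L
        (fun x => f (x + eta x)) f) by auto using test_minus.
      ring. }
  rewrite Rmult_assoc; apply HMb.
  - apply test_C1_0; auto using test_minus.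
  - intros x; destruct (HT1 x (eta x) d Hd (Hb x)) as [_ H].
    assert (0 <= d ^ 2) by apply pow2_ge_0; nra.
  - intros x.
    assert (Hs : smooth f) by apply Hf.
    assert (HD : is_derive (fun y : R => f (y + eta y) - f y - eta y * Derive f y) x
      ((1 + Derive eta x) * Derive f (x + eta x) - Derive f x -
        (Derive eta x * Derive f x + eta x * Derive (Derive f) x))).
    { assert (ex_derive f (x + eta x)) by now apply smooth_ex_derive.
      assert (ex_derive f x) by now apply smooth_ex_derive.
      assert (ex_derive eta x) by now apply smooth_ex_derive.
      assert (ex_derive (Derive f) x) by now apply smooth_ex_derive, smooth_Derive.
      apply (is_derive_minus (fun y : R => f (y + eta y) - f y)
               (fun y : R => eta y * Derive f y)).
      - apply (is_derive_minus (fun y : R => f (y + eta y)) f).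
        + apply (is_derive_comp f (fun y => y + eta y)).
          * now apply Derive_correct.
          * apply (is_derive_plus (fun y => y) eta);
              [apply (is_derive_id x) | now apply Derive_correct].
        + now apply Derive_correct.
      - apply (is_derive_mult eta (Derive f)); try now apply Derive_correct.
        apply Rmult_comm. }
    (* The derivative of the remainder is the Taylor remainder of [Derive f] plus a product of two
       terms of order [d], hence [2 * K2] in the constant. *)
    replace (Derive (fun y : R => f (y + eta y) - f y - eta y * Derive f y) x) with
      ((Derive f (x + eta x) - Derive f x - eta x * Derive (Derive f) x) +
       Derive eta x * (Derive f (x + eta x) - Derive f x)).
    2:{ symmetry; rewrite (is_derive_unique _ _ _ HD); ring. }
    apply Rle_trans with (1 := Rabs_triang _ _).
    destruct (HT2 x (eta x) d Hd (Hb x)) as [H1 H2].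
    rewrite (Rabs_mult (Derive eta x)).
    assert (Rabs (Derive eta x) * Rabs (Derive f (x + eta x) - Derive f x) <= d * (K2 * d))
      by (apply Rmult_le_compat; auto using Rabs_pos).
    assert (0 <= d ^ 2) by apply pow2_ge_0; nra.
Qed.

Lemma affine_point_map (z0 w : C) : upper_half_plane z0 ->
  ((Im w / Im z0)%R * z0 + (Re w - Re z0 * (Im w / Im z0))%R)%C = w.
Proof.
  unfold upper_half_plane; intros Hz; rewrite RtoC_minus, !RtoC_mult.
  apply injective_projections; simpl; unfold Re, Im in *; field; lra.
Qed.

(** The affine map [A] with slope [a] that carries [z0] to [w] satisfies
    [(Id + f) o A = A o (Id + g)]; applying [E] and evaluating at [z0] transports the expansion to
    [w]. *)
Lemma extension_at_image (E : (R -> R) -> C -> C) (z0 w : C) (f : R -> R) :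
  admissible_extension E -> upper_half_plane z0 -> upper_half_plane w ->
  let a := Im w / Im z0 in
  let g := fun x => f (a * x + (Re w - Re z0 * a)) / a in
  BLplus (fun x => x + f x) -> BLplus (fun x => x + g x) ->
  E (fun x => x + f x) w = (w + a * (E (fun x => x + g x)%R z0 - z0))%C.
Proof.
  intros HE Hz Hw a g Hf Hg.
  assert (Ha : 0 < a) by now apply Rdiv_lt_0_compat.
  set (b := Re w - Re z0 * a) in *.
  assert (HA := BLplus_affine a b Ha).
  assert (Hmap : E (fun x => a * x + b) z0 = w).
  { rewrite (adm_affine E HE) by assumption; now apply affine_point_map. }
  rewrite <- Hmap at 1.
  rewrite <- (adm_comp E HE (fun x => x + f x) (fun x => a * x + b) Hf HA z0 Hz).
  replace (fun x => a * x + b + f (a * x + b)) with (fun x => a * (x + g x) + b).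
  2:{ apply functional_extensionality; intros x; unfold g; fold b; field; lra. }
  rewrite (adm_comp E HE (fun x => a * x + b) (fun x => x + g x) HA Hg z0 Hz).
  rewrite (adm_affine E HE) by (try apply (adm_hom E HE _ Hg); assumption).
  rewrite <- (affine_point_map z0 w Hz) at 1; fold a; fold b; ring.
Qed.

(** The affine coordinate whose extension sends [z0] to [Ci]; the affine map carrying [z0] to
    [z0 + p + q * Ci] is then [Id + p + q * normalized z0]. *)
Definition normalized (z0 : C) (x : R) : R := (x - Re z0) / Im z0.

Lemma smooth_normalized (z0 : C) : smooth (normalized z0).
Proof. unfold normalized; solve_smooth. Qed.

(* Compares [Id + t phi] after [Id + t psi] with its affine conjugate at the
   moved base point; the terms of order [t ^ 2] give the estimate. *)
Lemma product_rule_estimate (E : (R -> R) -> C -> C) (z0 : C) (L : (R -> R) -> C)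
    (phi psi : R -> R) :
  admissible_extension E -> upper_half_plane z0 -> bounded_linear_C1_0 L ->
  quadratically_tangent E z0 L -> test phi -> test psi ->
  let D := (L (fun x => psi x * Derive phi x)%R -
    (Re (L psi) * L (Derive phi) +
     Im (L psi) * L (fun x => normalized z0 x * Derive phi x)%R))%C in
  exists A B, 0 <= A /\ 0 <= B /\ forall c, 0 < c <= 1 ->
    exists t0, 0 < t0 /\ forall t, 0 < t < t0 -> Cmod D <= c * A + t * B.
Proof.
  intros HE Hz HL HT Hphi Hpsi D.
  set (m := normalized z0) in *.
  assert (Hm : smooth m) by apply smooth_normalized.
  destruct (test_bounded _ Hpsi) as [K1 [HK1 HK1b]].
  destruct (test_bounded _ (test_Derive _ Hpsi)) as [K2 [HK2 HK2b]].
  destruct (test_bounded _ (test_Derive _ Hphi)) as [K3 [HK3 HK3b]].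
  set (K := K1 + K2 + K3 + 1).
  assert (HK : 1 <= K) by (unfold K; lra).
  destruct (perturbed_expansion L phi HL Hphi) as [P [HP HPb]].
  assert (Hy : 0 < Im z0) by exact Hz.
  (* [t * Q] will bound the displacement of the base point, and [S] converts [1 + Rabs (m x)] into a
     multiple of [1 + Rabs x]. *)
  set (Q := Cmod (L psi) + K ^ 2).
  set (S := 1 + (1 + Rabs (Re z0)) / Im z0).
  assert (HQ : 1 <= Q) by (unfold Q; generalize (Cmod_ge_0 (L psi)); nra).
  assert (HS : 1 <= S).
  { assert (0 <= (1 + Rabs (Re z0)) / Im z0); [|unfold S; lra].
    apply Rdiv_le_0_compat; [generalize (Rabs_pos (Re z0)); lra | exact Hy]. }
  assert (HSy : / Im z0 <= S).
  { assert (0 <= Rabs (Re z0) * / Im z0).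
    { apply Rmult_le_pos; [apply Rabs_pos | left; now apply Rinv_0_lt_compat]. }
    unfold S, Rdiv; lra. }
  assert (HSm : forall x, 1 + Rabs (m x) <= S * (1 + Rabs x)).
  { intros x; unfold m, normalized; rewrite Rabs_div_pos by exact Hy.
    assert (Rabs (x - Re z0) / Im z0 <= (Rabs x + Rabs (Re z0)) / Im z0).
    { apply Rmult_le_compat_r; [left; now apply Rinv_0_lt_compat|].
      unfold Rminus; apply Rle_trans with (1 := Rabs_triang _ _); rewrite Rabs_Ropp; lra. }
    assert (0 <= Rabs x * (1 + Rabs (Re z0) * / Im z0)).
    { apply Rmult_le_pos; [apply Rabs_pos|].
      assert (0 <= Rabs (Re z0) * / Im z0); [|lra].
      apply Rmult_le_pos; [apply Rabs_pos | left; now apply Rinv_0_lt_compat]. }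
    assert (0 <= / Im z0) by (left; now apply Rinv_0_lt_compat).
    unfold S, Rdiv in *; nra. }
  assert (HmD : forall x, Derive m x = / Im z0).
  { intros x; apply is_derive_unique; unfold m, normalized.
    auto_derive; [exact I | field; lra]. }
  (* The three tangency remainders contribute 1, 2 (a factor [a <= 2]) and 9 (a slope bound three
     times as large), in all 12. *)
  exists (12 * K ^ 2 + K ^ 2 * (Cmod (L (Derive phi)) + Cmod (L (fun x => m x * Derive phi x)))).
  exists (P * K ^ 2 + P * (Q * S) ^ 2).
  generalize (Cmod_ge_0 (L (Derive phi))) (Cmod_ge_0 (L (fun x => m x * Derive phi x))).
  intros HC1 HC2.
  assert (HK2p : 1 <= K ^ 2) by nra.
  split; [nra|]; split.
  { apply Rplus_le_le_0_compat; apply Rmult_le_pos; try lra; apply pow2_ge_0. }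
  intros c Hc; destruct (HT c (proj1 Hc)) as [e [He Htan]].
  set (T := 3 * K + Q * S + 1).
  assert (HT1 : 1 <= T) by (unfold T; nra).
  exists (Rmin (1 / 6) (e / 2) / T); split.
  { apply Rdiv_lt_0_compat; [apply Rmin_glb_lt|]; lra. }
  intros t [Ht Htlt].
  assert (HtT : t * T < Rmin (1 / 6) (e / 2)).
  { apply Rmult_lt_reg_r with (/ T); [apply Rinv_0_lt_compat; lra|].
    replace (t * T * / T) with t by (field; lra); exact Htlt. }
  assert (HtT1 := Rlt_le_trans _ _ _ HtT (Rmin_l _ _)).
  assert (HtT2 := Rlt_le_trans _ _ _ HtT (Rmin_r _ _)).
  assert (HQS : 1 <= Q * S) by nra.
  assert (Hscale : forall u, 0 <= u <= T -> 0 <= t * u <= t * T).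
  { intros u Hu; split; [apply Rmult_le_pos | apply Rmult_le_compat_l]; lra. }
  assert (HtK := Hscale K ltac:(unfold T; lra)).
  assert (HtK3 := Hscale (3 * K) ltac:(unfold T; lra)).
  assert (HtQS := Hscale (Q * S) ltac:(unfold T; lra)).
  assert (Htt := Hscale 1 ltac:(lra)).
  assert (Hspsi := proj1 Hpsi); assert (Hsphi := proj1 Hphi).
  assert (Htpsi := test_scal t psi Hpsi); assert (Htphi := test_scal t phi Hphi).
  assert (Habs : forall u k : R, Rabs u <= k -> k <= K -> Rabs (t * u) <= t * K).
  { intros u k H1 H2; rewrite Rabs_mult, (Rabs_pos_eq t) by lra.
    apply Rmult_le_compat_l; lra. }
  assert (HDpsi : forall x, Rabs (Derive (fun x => t * psi x) x) <= t * K).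
  { intros x; rewrite Derive_scal; apply Habs with K2; [apply HK2b | unfold K; lra]. }
  assert (HDphi : forall x, Rabs (Derive (fun x => t * phi x) x) <= t * K).
  { intros x; rewrite Derive_scal; apply Habs with K3; [apply HK3b | unfold K; lra]. }
  assert (Hbl : forall f, test f -> (forall x, Rabs (Derive f x) <= 1 / 2) ->
                  BLplus (fun x => x + f x)).
  { intros f Hf Hb; apply BLplus_near_id; [apply smooth_C1, Hf | exact Hb]. }
  assert (HBpsi : BLplus (fun x => x + t * psi x)).
  { apply (Hbl (fun x => t * psi x)); [exact Htpsi|]; intros x.
    apply Rle_trans with (1 := HDpsi x); lra. }
  assert (HBphi : BLplus (fun x => x + t * phi x)).
  { apply (Hbl (fun x => t * phi x)); [exact Htphi|]; intros x.
    apply Rle_trans with (1 := HDphi x); lra. }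
  set (w := E (fun x => x + t * psi x) z0).
  assert (Hw : upper_half_plane w) by (apply (adm_hom E HE _ HBpsi), Hz).
  assert (Hr1 := Htan _ (t * K) Htpsi ltac:(lra) HDpsi); cbv beta in Hr1; fold w in Hr1.
  rewrite (bl_scal L HL) in Hr1 by now apply test_C1_0.
  set (r1 := (w - (z0 + t * L psi))%C) in Hr1.
  set (p := Re w - Re z0); set (q := Im w - Im z0).
  assert (HtK2 : (t * K) ^ 2 <= t * K ^ 2).
  { replace ((t * K) ^ 2) with (t * K ^ 2 * t) by ring; nra. }
  assert (Hwz : Cmod (w - z0)%C <= t * Q).
  { replace (w - z0)%C with (t * L psi + r1)%C by (unfold r1; ring).
    apply Rle_trans with (1 := Cmod_triangle _ _).
    rewrite Cmod_mult, Cmod_R, (Rabs_pos_eq t) by lra.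
    assert (c * (t * K) ^ 2 <= 1 * (t * K) ^ 2)
      by (apply Rmult_le_compat_r; [apply pow2_ge_0 | lra]).
    unfold Q; lra. }
  assert (Hp : Rabs p <= t * Q).
  { apply Rle_trans with (2 := Hwz), (re_le_Cmod (w - z0)%C). }
  assert (Hq : Rabs q <= t * Q).
  { apply Rle_trans with (2 := Hwz), (im_le_Cmod (w - z0)%C). }
  set (eta := fun x => p + q * m x).
  assert (Hseta : smooth eta) by (unfold eta; solve_smooth).
  assert (HtQ0 : 0 <= t * Q) by nra.
  assert (Heta : forall x, Rabs (eta x) <= t * (Q * S) * (1 + Rabs x)).
  { intros x; unfold eta; apply Rle_trans with (1 := Rabs_triang _ _).
    rewrite Rabs_mult.
    assert (Rabs q * Rabs (m x) <= t * Q * Rabs (m x))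
      by (apply Rmult_le_compat_r; [apply Rabs_pos | exact Hq]).
    assert (t * Q * (1 + Rabs (m x)) <= t * Q * (S * (1 + Rabs x)))
      by (apply Rmult_le_compat_l; [exact HtQ0 | apply HSm]).
    nra. }
  assert (HDeta0 : forall x, Derive eta x = q * / Im z0).
  { intros x; unfold eta; rewrite (Derive_plus (fun _ => p)), Derive_const, Derive_scal, HmD.
    - ring.
    - apply ex_derive_const.
    - apply smooth_ex_derive; solve_smooth. }
  assert (HDeta : forall x, Rabs (Derive eta x) <= t * (Q * S)).
  { intros x; rewrite HDeta0, Rabs_mult, (Rabs_pos_eq (/ Im z0))
      by (left; now apply Rinv_0_lt_compat).
    rewrite <- Rmult_assoc; apply Rmult_le_compat; auto using Rabs_pos.
    left; now apply Rinv_0_lt_compat. }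
  set (a := Im w / Im z0).
  assert (Ha1 : a = 1 + q * / Im z0) by (unfold a, q; field; lra).
  assert (Ha : 1 / 2 <= a <= 2).
  { generalize (HDeta 0); rewrite HDeta0; intros H; apply Rabs_le_between in H; lra. }
  assert (Hconj : forall x, a * x + (Re w - Re z0 * a) = x + eta x).
  { intros x; unfold eta, m, normalized, p, q, a; field; lra. }
  assert (Hteta : test (fun x => phi (x + eta x))).
  { apply test_perturbed with (t * (Q * S)); auto; lra. }
  set (g := fun x => t * phi (a * x + (Re w - Re z0 * a)) / a).
  assert (Hg : g = (fun x => t / a * phi (x + eta x))).
  { apply functional_extensionality; intros x; unfold g; rewrite Hconj; field; lra. }
  assert (Htg : test g) by (rewrite Hg; now apply test_scal).
  assert (HDg : forall x, Rabs (Derive g x) <= t * K).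
  { intros x.
    assert (HD : is_derive g x (t * Derive phi (a * x + (Re w - Re z0 * a)))).
    { unfold g.
      assert (ex_derive phi (a * x + (Re w - Re z0 * a))) by now apply smooth_ex_derive.
      auto_derive; [assumption|].
      change (fun x0 => phi x0) with phi; unfold Rminus; field; lra. }
    rewrite (is_derive_unique _ _ _ HD); apply Habs with K3; [apply HK3b | unfold K; lra]. }
  assert (HBg : BLplus (fun x => x + g x)).
  { apply Hbl; [exact Htg|]; intros x; apply Rle_trans with (1 := HDg x); lra. }
  assert (Hr3 := Htan g (t * K) Htg ltac:(lra) HDg).
  assert (HLg : L g = ((t / a)%R * L (fun x => phi (x + eta x))%R)%C).
  { rewrite Hg; apply (bl_scal L HL); now apply test_C1_0. }
  rewrite HLg in Hr3.
  set (r3 := (_ - _)%C) in Hr3.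
  assert (Htc : test (fun x => phi (x + t * psi x))).
  { apply (test_perturbed phi (fun x => t * psi x) (t * K)); auto; [apply Htpsi|lra|].
    intros x; apply Rle_trans with (t * K).
    - apply Habs with K1; [apply HK1b | unfold K; lra].
    - generalize (Rabs_pos x); nra. }
  (* The composition [Id + t phi] after [Id + t psi] is [Id + chi]. *)
  set (chi := fun x => t * psi x + t * phi (x + t * psi x)).
  assert (Hchi : test chi).
  { apply (test_plus (fun x => t * psi x) (fun x => t * phi (x + t * psi x))); auto.
    now apply test_scal. }
  assert (HDchi : forall x, Rabs (Derive chi x) <= 3 * (t * K)).
  { intros x.
    assert (HD : is_derive chi x
      (t * Derive psi x + t * ((1 + t * Derive psi x) * Derive phi (x + t * psi x)))).
    { assert (ex_derive psi x) by now apply smooth_ex_derive.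
      assert (ex_derive phi (x + t * psi x)) by now apply smooth_ex_derive.
      unfold chi; auto_derive; [auto|].
      change (fun x0 => phi x0) with phi; change (fun x0 => psi x0) with psi; ring. }
    rewrite (is_derive_unique _ _ _ HD).
    apply Rle_trans with (1 := Rabs_triang _ _).
    assert (H1 : Rabs (t * Derive psi x) <= t * K)
      by (apply Habs with K2; [apply HK2b | unfold K; lra]).
    assert (H2 : Rabs (t * Derive phi (x + t * psi x)) <= t * K)
      by (apply Habs with K3; [apply HK3b | unfold K; lra]).
    replace (t * ((1 + t * Derive psi x) * Derive phi (x + t * psi x)))
      with ((1 + t * Derive psi x) * (t * Derive phi (x + t * psi x))) by ring.
    rewrite (Rabs_mult (1 + _)).
    assert (H3 : Rabs (1 + t * Derive psi x) <= 2).
    { apply Rle_trans with (1 := Rabs_triang _ _); rewrite Rabs_R1; lra. }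
    assert (Rabs (1 + t * Derive psi x) * Rabs (t * Derive phi (x + t * psi x)) <= 2 * (t * K))
      by (apply Rmult_le_compat; auto using Rabs_pos).
    lra. }
  assert (Hr2 := Htan chi (3 * (t * K)) Hchi ltac:(lra) HDchi).
  set (r2 := (_ - _)%C) in Hr2.
  assert (HLchi : L chi = (t * L psi + t * L (fun x => phi (x + t * psi x))%R)%C).
  { unfold chi; rewrite (bl_plus L HL (fun x => t * psi x)), !(bl_scal L HL);
      auto using test_C1_0, test_scal. }
  assert (Hcomp : E (fun x => x + chi x) z0 = (w + a * (E (fun x => x + g x)%R z0 - z0))%C).
  { assert (Hx := extension_at_image E z0 w (fun x => t * phi x) HE Hz Hw HBphi HBg).
    change (E (fun x => x + t * phi x) w =
            (w + a * (E (fun x => x + g x)%R z0 - z0))%C) in Hx.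
    rewrite <- Hx; unfold w; rewrite <- (adm_comp E HE _ _ HBphi HBpsi z0 Hz).
    f_equal; apply functional_extensionality; intros x; unfold chi; ring. }
  (* The common term [t * L psi] cancels, and the factor [a] of the conjugation cancels the division
     by [a] in [g]; two perturbed values of [L phi] remain. *)
  assert (Hmain : (t * (L (fun x => phi (x + t * psi x)%R) - L (fun x => phi (x + eta x)%R)) =
                   r1 + a * r3 - r2)%C).
  { replace (r1 + a * r3 - r2)%C with
      (L chi - t * L psi + (w - E (fun x => x + chi x)%R z0) +
       a * (E (fun x => x + g x)%R z0 - z0) - a * (t / a)%R * L (fun x => phi (x + eta x)%R))%C
      by (unfold r1, r2, r3; ring).
    rewrite Hcomp, HLchi, <- RtoC_mult; replace (a * (t / a)) with t by (field; lra); ring. }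
  assert (He1 := HPb (fun x => t * psi x) (t * K) ltac:(apply Htpsi) ltac:(lra)).
  assert (He2 := HPb eta (t * (Q * S)) Hseta ltac:(lra) Heta HDeta).
  cbv beta in He1.
  specialize (He1 ltac:(intros x; apply Rle_trans with (t * K);
    [apply Habs with K1; [apply HK1b | unfold K; lra] | generalize (Rabs_pos x); nra]) HDpsi).
  set (W := L (fun x => m x * Derive phi x)) in *.
  assert (HL1 : L (fun x => t * psi x * Derive phi x) =
                (t * L (fun x => psi x * Derive phi x)%R)%C).
  { rewrite <- (bl_scal L HL) by now apply test_C1_0, test_mult_l, test_Derive.
    f_equal; apply functional_extensionality; intros x; ring. }
  assert (HL2 : L (fun x => eta x * Derive phi x) = (p * L (Derive phi) + q * W)%C).
  { unfold W; rewrite <- !(bl_scal L HL), <- (bl_plus L HL); auto 6 using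
      test_C1_0, test_scal, test_mult_l, test_Derive.
    f_equal; apply functional_extensionality; intros x; unfold eta; ring. }
  rewrite HL1 in He1; rewrite HL2 in He2.
  set (e1 := (_ - _)%C) in He1; set (e2 := (_ - _)%C) in He2.
  assert (HpD : RtoC p = (t * Re (L psi) + Re r1)%C).
  { unfold p, r1; rewrite <- RtoC_mult, <- RtoC_plus; f_equal.
    unfold Cminus; rewrite re_plus, re_opp, re_plus, re_scal_l; ring. }
  assert (HqD : RtoC q = (t * Im (L psi) + Im r1)%C).
  { unfold q, r1; rewrite <- RtoC_mult, <- RtoC_plus; f_equal.
    unfold Cminus; rewrite im_plus, im_opp, im_plus, im_scal_l; ring. }
  (* Three sources of error: tangency remainders, small through [c]; Taylor remainders, of order
     [t ^ 3]; and the replacement of [p] and [q] by their linear parts, small through [r1]. *)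
  assert (HD : ((t * t)%R * D = (r1 + a * r3 + - r2) + (t * e2 + - (t * e1)) +
                (t * (Re r1 * L (Derive phi)) + t * (Im r1 * W)))%C).
  { replace (r1 + a * r3 + - r2)%C with (r1 + a * r3 - r2)%C by ring.
    rewrite <- Hmain; unfold e1, e2, D; fold W; rewrite HpD, HqD, RtoC_mult; ring. }
  apply Rmult_le_reg_l with (t * t); [nra|].
  rewrite <- (Rabs_pos_eq (t * t)) at 1 by nra.
  rewrite <- Cmod_R, <- Cmod_mult, HD; clear HD.
  assert (Hct : 0 <= c * (t * K) ^ 2) by (apply Rmult_le_pos; [lra | apply pow2_ge_0]).
  assert (N1 : Cmod (r1 + a * r3 + - r2)%C <= 12 * (c * (t * K) ^ 2)).
  { apply Rle_trans with (1 := Cmod_triangle _ _).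
    rewrite Cmod_opp.
    assert (Cmod (r1 + a * r3)%C <= 3 * (c * (t * K) ^ 2)).
    { apply Rle_trans with (1 := Cmod_triangle _ _).
      rewrite Cmod_mult, Cmod_R, (Rabs_pos_eq a) by lra.
      assert (a * Cmod r3 <= 2 * (c * (t * K) ^ 2))
        by (apply Rmult_le_compat; auto using Cmod_ge_0; lra).
      lra. }
    replace (c * (3 * (t * K)) ^ 2) with (9 * (c * (t * K) ^ 2)) in Hr2 by ring; lra. }
  assert (N2 : Cmod (t * e2 + - (t * e1))%C <=
               t * (P * (t * (Q * S)) ^ 2) + t * (P * (t * K) ^ 2)).
  { apply Rle_trans with (1 := Cmod_triangle _ _).
    rewrite Cmod_opp, !Cmod_mult, Cmod_R, (Rabs_pos_eq t) by lra.
    apply Rplus_le_compat; apply Rmult_le_compat_l; lra. }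
  assert (N3 : Cmod (t * (Re r1 * L (Derive phi)) + t * (Im r1 * W))%C <=
               c * (t * K) ^ 2 * (Cmod (L (Derive phi)) + Cmod W)).
  { apply Rle_trans with (1 := Cmod_triangle _ _).
    rewrite !Cmod_mult, !Cmod_R, (Rabs_pos_eq t), Rmult_plus_distr_l by lra.
    assert (Hone : forall u v : R, 0 <= u <= c * (t * K) ^ 2 -> 0 <= v ->
                     t * (u * v) <= c * (t * K) ^ 2 * v).
    { intros u v Hu Hv; apply Rle_trans with (1 * (u * v)).
      - apply Rmult_le_compat_r; [apply Rmult_le_pos|]; lra.
      - rewrite Rmult_1_l; apply Rmult_le_compat_r; lra. }
    apply Rplus_le_compat; apply Hone; auto using Cmod_ge_0; split; auto using Rabs_pos.
    - apply Rle_trans with (1 := re_le_Cmod r1), Hr1.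
    - apply Rle_trans with (1 := im_le_Cmod r1), Hr1. }
  apply Rle_trans with (1 := Cmod_triangle _ _).
  apply Rle_trans with (1 := Rplus_le_compat_r _ _ _ (Cmod_triangle _ _)).
  apply Rle_trans with (1 := Rplus_le_compat _ _ _ _ (Rplus_le_compat _ _ _ _ N1 N2) N3).
  right; ring.
Qed.

(** The defect depends on neither [c] nor [t], so it vanishes: [c] is made small first, then [t]
    below the threshold attached to [c]. *)
Lemma product_rule (E : (R -> R) -> C -> C) (z0 : C) (L : (R -> R) -> C)
    (phi psi : R -> R) :
  admissible_extension E -> upper_half_plane z0 -> bounded_linear_C1_0 L ->
  quadratically_tangent E z0 L -> test phi -> test psi ->
  L (fun x => psi x * Derive phi x) =
    (Re (L psi) * L (Derive phi) +
     Im (L psi) * L (fun x => normalized z0 x * Derive phi x)%R)%C.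
Proof.
  intros HE Hz HL HT Hphi Hpsi.
  destruct (product_rule_estimate E z0 L phi psi HE Hz HL HT Hphi Hpsi)
    as [A [B [HA [HB H]]]].
  set (U := (_ * _ + _ * _)%C) in *.
  replace (L (fun x => psi x * Derive phi x)) with
    (L (fun x => psi x * Derive phi x)%R - U + U)%C by ring.
  set (D := (L (fun x => psi x * Derive phi x)%R - U)%C) in *.
  rewrite (Cmod_eq_0 D); [ring|].
  destruct (Req_dec (Cmod D) 0) as [E0|E0]; [exact E0|exfalso].
  assert (Hd : 0 < Cmod D) by (generalize (Cmod_ge_0 D); lra).
  set (c := Rmin 1 (Cmod D / (4 * (A + 1)))).
  assert (Hc : 0 < c) by (apply Rmin_glb_lt; [lra | apply Rdiv_lt_0_compat; lra]).
  destruct (H c (conj Hc (Rmin_l _ _))) as [t0 [Ht0 Hest]].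
  set (t := Rmin (t0 / 2) (Cmod D / (4 * (B + 1)))).
  assert (Ht : 0 < t) by (apply Rmin_glb_lt; [lra | apply Rdiv_lt_0_compat; lra]).
  assert (Htt : t <= t0 / 2) by apply Rmin_l.
  generalize (Hest t ltac:(lra)).
  assert (Hc1 : c * (A + 1) <= Cmod D / 4).
  { replace (Cmod D / 4) with (Cmod D / (4 * (A + 1)) * (A + 1)) by (field; lra).
    apply Rmult_le_compat_r; [lra | apply Rmin_r]. }
  assert (Ht1 : t * (B + 1) <= Cmod D / 4).
  { replace (Cmod D / 4) with (Cmod D / (4 * (B + 1)) * (B + 1)) by (field; lra).
    apply Rmult_le_compat_r; [lra | apply Rmin_r]. }
  lra.
Qed.

(** * Annihilators and divided differences *)

(** Truncations of 1 and [Id] have images close to 1 and [z0], which are independent over the reals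
    because [Im z0] is positive. Independence survives a small error, and Cramer's rule then hits 1
    and [Ci] exactly. *)
Lemma functional_onto (E : (R -> R) -> C -> C) (z0 : C) (L : (R -> R) -> C) :
  admissible_extension E -> upper_half_plane z0 -> bounded_linear_C1_0 L ->
  quadratically_tangent E z0 L ->
  exists f g, test f /\ test g /\ L f = RtoC 1 /\ L g = Ci.
Proof.
  intros HE Hz HL HT.
  assert (Hy : 0 < Im z0) by exact Hz.
  set (x0 := Re z0); set (y0 := Im z0) in Hy.
  (* The determinant [a * d - b * c] differs from [y0] by at most [eps * (3 + y0 + Rabs x0)], hence
     by at most half of [y0]. *)
  set (eps := Rmin 1 (y0 / (2 * (3 + y0 + Rabs x0)))).
  generalize (Rabs_pos x0); intros Hx0.
  assert (Heps : 0 < eps) by (apply Rmin_glb_lt; [lra | apply Rdiv_lt_0_compat; lra]).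
  assert (Heps1 : eps <= 1) by apply Rmin_l.
  assert (Heps2 : eps * (3 + y0 + Rabs x0) <= y0 / 2).
  { replace (y0 / 2) with (y0 / (2 * (3 + y0 + Rabs x0)) * (3 + y0 + Rabs x0))
      by (field; lra).
    apply Rmult_le_compat_r; [lra | apply Rmin_r]. }
  destruct (affine_cutoff_limit E z0 L 0 1 HE Hz HL HT eps Heps) as [N1 H1].
  destruct (affine_cutoff_limit E z0 L 1 0 HE Hz HL HT eps Heps) as [N2 H2].
  set (N := (N1 + N2)%nat).
  specialize (H1 N ltac:(unfold N; lia)); specialize (H2 N ltac:(unfold N; lia)).
  set (f := affine_cutoff 0 1 N) in *; set (g := affine_cutoff 1 0 N) in *.
  assert (Hf : test f) by apply test_affine_cutoff.
  assert (Hg : test g) by apply test_affine_cutoff.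
  set (r := (L f - (0 * z0 + 1))%C) in *; set (s := (L g - (1 * z0 + 0))%C) in *.
  assert (Hr1 := Rle_lt_trans _ _ _ (re_le_Cmod r) H1).
  assert (Hr2 := Rle_lt_trans _ _ _ (im_le_Cmod r) H1).
  assert (Hs1 := Rle_lt_trans _ _ _ (re_le_Cmod s) H2).
  assert (Hs2 := Rle_lt_trans _ _ _ (im_le_Cmod s) H2).
  set (a := Re (L f)); set (b := Im (L f)); set (c := Re (L g)); set (d := Im (L g)).
  replace (Re r) with (a - 1) in Hr1 by (unfold a, r, Re, Im; simpl; ring).
  replace (Im r) with b in Hr2 by (unfold b, r, Re, Im; simpl; ring).
  replace (Re s) with (c - x0) in Hs1 by (unfold c, x0, s, Re, Im; simpl; ring).
  replace (Im s) with (d - y0) in Hs2 by (unfold d, y0, s, Re, Im; simpl; ring).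
  assert (Hdet : 0 < a * d - b * c).
  { assert (Hprod : forall u v M, Rabs u < eps -> Rabs v <= M -> Rabs (u * v) <= eps * M).
    { intros u v M Hu Hv; rewrite Rabs_mult; apply Rmult_le_compat; auto using Rabs_pos; lra. }
    assert (T1 := Hprod (a - 1) y0 y0 Hr1 ltac:(rewrite Rabs_pos_eq; lra)).
    assert (T2 := Hprod (a - 1) (d - y0) 1 Hr1 ltac:(lra)).
    assert (T3 := Hprod b x0 (Rabs x0) Hr2 ltac:(lra)).
    assert (T4 := Hprod b (c - x0) 1 Hr2 ltac:(lra)).
    apply Rabs_le_between in T1; apply Rabs_le_between in T2.
    apply Rabs_le_between in T3; apply Rabs_le_between in T4.
    apply Rabs_def2 in Hs2; lra. }
  assert (Hcomb : forall k l, test (fun x => k * f x + l * g x) /\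
            L (fun x => k * f x + l * g x) = (k * L f + l * L g)%C).
  { intros k l; split; [apply test_plus; now apply test_scal|].
    rewrite (bl_plus L HL (fun x => k * f x)), !(bl_scal L HL);
      auto using test_C1_0, test_scal. }
  set (D := a * d - b * c) in *.
  exists (fun x => d / D * f x + - b / D * g x), (fun x => - c / D * f x + a / D * g x).
  destruct (Hcomb (d / D) (- b / D)) as [Hf1 ->].
  destruct (Hcomb (- c / D) (a / D)) as [Hg1 ->].
  split; [exact Hf1|]; split; [exact Hg1|].
  split; apply injective_projections; simpl; fold (Re (L f)) (Im (L f)) (Re (L g)) (Im (L g));
    fold a b c d; unfold D in *; field; lra.
Qed.

Lemma smooth_cutoff (f : R -> R) (A : R) : 0 < A -> smooth f ->
  exists g, test g /\ forall x, Rabs x < A -> g x = f x /\ Derive g x = Derive f x.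
Proof.
  intros HA Hf; exists (fun x => f x * bump (x / A)); split.
  - apply test_mult_l; [exact Hf | now apply test_bump_scaled].
  - assert (H : forall x, Rabs x < A -> f x * bump (x / A) = f x).
    { intros x Hx; rewrite bump_scaled_in; lra. }
    intros x Hx; split; [now apply H|]; apply Derive_ext_loc.
    apply filter_imp with (fun y => Rabs y < A); [exact H|].
    apply (continuous_Rabs x (fun z => z < A)); now apply open_lt.
Qed.

(** The product rule makes [L (m f)] real-linear in [L f], with coefficients that depend on the
    auxiliary [phi]. Using one [phi] for [f], [f1] and [f2] identifies these coefficients with
    values at [f1] and [f2], independent of [f]. *)
Lemma multiplication_matrix (E : (R -> R) -> C -> C) (z0 : C) (L : (R -> R) -> C) :
  admissible_extension E -> upper_half_plane z0 -> bounded_linear_C1_0 L ->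
  quadratically_tangent E z0 L ->
  exists s t : C, forall f, test f ->
    L (fun x => normalized z0 x * f x) = (Re (L f) * s + Im (L f) * t)%C.
Proof.
  intros HE Hz HL HT.
  assert (Hy : 0 < Im z0) by exact Hz.
  set (m := normalized z0).
  destruct (functional_onto E z0 L HE Hz HL HT) as [f1 [f2 [Hf1 [Hf2 [HL1 HL2]]]]].
  exists (L (fun x => m x * f1 x)), (L (fun x => m x * f2 x)); intros f Hf.
  destruct (proj2 Hf1) as [A1 [HA1 Hz1]].
  destruct (proj2 Hf2) as [A2 [HA2 Hz2]].
  destruct (proj2 Hf) as [A [HA Hz0]].
  (* A primitive of [m], cut off outside the supports of all three functions. *)
  destruct (smooth_cutoff (fun x => Im z0 / 2 * (m x * m x)) (A + A1 + A2))
    as [phi [Hphi Hloc]].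
  { lra. }
  { assert (H := smooth_normalized z0); fold m in H; solve_smooth. }
  assert (HDm : forall x, Derive (fun x => Im z0 / 2 * (m x * m x)) x = m x).
  { intros x; apply is_derive_unique; unfold m, normalized.
    auto_derive; [auto | field; lra]. }
  assert (Hmul : forall g B, (forall x, B <= Rabs x -> g x = 0) -> B <= A + A1 + A2 ->
            test g -> L (fun x => m x * g x) =
            (Re (L g) * L (Derive phi) + Im (L g) * L (fun x => m x * Derive phi x)%R)%C).
  { intros g B HB HBA Hg.
    unfold m; rewrite <- (product_rule E z0 L phi g) by assumption; fold m.
    f_equal; apply functional_extensionality; intros x.
    destruct (Rlt_le_dec (Rabs x) B) as [H|H].
    - destruct (Hloc x ltac:(lra)) as [_ ->]; rewrite HDm; ring.
    - rewrite HB by exact H; ring. }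
  rewrite (Hmul f1 A1 Hz1 ltac:(lra) Hf1), (Hmul f2 A2 Hz2 ltac:(lra) Hf2).
  rewrite (Hmul f A Hz0 ltac:(lra) Hf), HL1, HL2.
  apply injective_projections; simpl; ring.
Qed.

(* Cayley-Hamilton for multiplication by [normalized z0] on the two-dimensional
   quotient of the test functions by the kernel of [L]. *)
Lemma quadratic_annihilator (E : (R -> R) -> C -> C) (z0 : C) (L : (R -> R) -> C) :
  admissible_extension E -> upper_half_plane z0 -> bounded_linear_C1_0 L ->
  quadratically_tangent E z0 L ->
  exists tr det : R, forall f, test f ->
    L (fun x => (normalized z0 x ^ 2 - tr * normalized z0 x + det) * f x) = RtoC 0.
Proof.
  intros HE Hz HL HT.
  destruct (multiplication_matrix E z0 L HE Hz HL HT) as [s [t Hst]].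
  set (m := normalized z0) in *.
  assert (Hm : smooth m) by apply smooth_normalized.
  (* Trace and determinant of the real matrix with columns [s] and [t]. *)
  exists (Re s + Im t), (Re s * Im t - Im s * Re t); intros f Hf.
  set (tr := Re s + Im t); set (det := Re s * Im t - Im s * Re t).
  assert (Hmf := test_mult_l m f Hm Hf).
  assert (Hmmf := test_mult_l m _ Hm Hmf).
  replace (fun x => (m x ^ 2 - tr * m x + det) * f x)
    with (fun x => (m x * (m x * f x) + (- tr) * (m x * f x)) + det * f x).
  2:{ apply functional_extensionality; intros x; ring. }
  rewrite (bl_plus L HL (fun x => m x * (m x * f x) + - tr * (m x * f x))
             (fun x => det * f x)); [|apply test_C1_0; auto using test_plus, test_scal..].
  rewrite (bl_plus L HL (fun x => m x * (m x * f x)) (fun x => - tr * (m x * f x)));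
    [|apply test_C1_0; auto using test_scal..].
  rewrite !(bl_scal L HL) by now apply test_C1_0.
  rewrite (Hst _ Hmf), (Hst _ Hf).
  apply injective_projections; unfold tr, det, Re, Im; simpl; ring.
Qed.

Lemma two_point_annihilator (E : (R -> R) -> C -> C) (z0 : C) (L : (R -> R) -> C) :
  admissible_extension E -> upper_half_plane z0 -> bounded_linear_C1_0 L ->
  quadratically_tangent E z0 L ->
  exists p q : R, q <= p /\ forall f, test f ->
    L (fun x => (x - (Re z0 + p * Im z0)) * ((x - (Re z0 + q * Im z0)) * f x)) = RtoC 0.
Proof.
  intros HE Hz HL HT.
  assert (Hy : 0 < Im z0) by exact Hz.
  destruct (quadratic_annihilator E z0 L HE Hz HL HT) as [tr [det Hann]].
  assert (Hm := smooth_normalized z0).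
  set (m := normalized z0) in *.
  destruct (Rlt_le_dec (tr ^ 2 - 4 * det) 0) as [Hneg|Hpos].
  - exfalso.
    destruct (functional_onto E z0 L HE Hz HL HT) as [f [_ [Hf [_ [HLf _]]]]].
    assert (HP : forall x, m x * m x - tr * m x + det <> 0).
    { intros x; generalize (pow2_ge_0 (m x - tr / 2)); nra. }
    assert (HPi : smooth (fun x => / (m x * m x - tr * m x + det)))
      by (apply smooth_inv; [exact HP | solve_smooth]).
    generalize (Hann _ (test_mult_l _ f HPi Hf)).
    replace (fun x => (m x ^ 2 - tr * m x + det) * (/ (m x * m x - tr * m x + det) * f x))
      with f.
    + rewrite HLf; intros H; apply RtoC_inj in H; lra.
    + apply functional_extensionality; intros x; field; apply HP.
  - set (s := sqrt (tr ^ 2 - 4 * det)).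
    assert (Hs : s * s = tr ^ 2 - 4 * det) by (apply sqrt_sqrt; exact Hpos).
    assert (Hs0 : 0 <= s) by apply sqrt_pos.
    exists ((tr + s) / 2), ((tr - s) / 2); split; [lra|]; intros f Hf.
    (* The factor [Im z0 ^ 2] clears the denominators of [normalized], leaving a polynomial monic in
       [x]. *)
    rewrite <- (Hann _ (test_scal (Im z0 ^ 2) f Hf)).
    f_equal; apply functional_extensionality; intros x.
    replace det with ((tr ^ 2 - s * s) / 4) by lra.
    unfold m, normalized; field; lra.
Qed.

Definition divided_difference (f : R -> R) (p q : R) : R :=
  if Req_EM_T p q then Derive f p else (f p - f q) / (p - q).

Lemma test_divide (f : R -> R) (p : R) : test f -> f p = 0 ->
  exists g, test g /\ forall x, f x = (x - p) * g x.
Proof.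
  intros [Hs [A [HA Hz]]] Hp.
  destruct (smooth_divide f p Hs Hp) as [g [Hg Hfg]].
  exists g; split; [|exact Hfg]; split; [exact Hg|].
  (* Outside this radius [x] differs from [p], so vanishing of [f] forces vanishing of the
     quotient. *)
  exists (A + Rabs p + 1); generalize (Rabs_pos p); intros H; split; [lra|].
  intros x Hx.
  assert (Hxp : x - p <> 0) by (intros H'; replace x with p in Hx by lra; lra).
  generalize (Hfg x); rewrite Hz by lra; intros H0.
  apply Rmult_eq_reg_l with (x - p); lra.
Qed.

(** When [f p = 0], the value at [q] of the first quotient is the divided difference of [f], also
    for [p = q], so a second division is possible. *)
Lemma test_divide_two (f : R -> R) (p q : R) : test f -> f p = 0 ->
  divided_difference f p q = 0 ->
  exists g, test g /\ forall x, f x = (x - p) * ((x - q) * g x).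
Proof.
  intros Hf Hp Hd.
  destruct (test_divide f p Hf Hp) as [g [Hg Hfg]].
  assert (Hq : g q = 0).
  { unfold divided_difference in Hd; destruct (Req_EM_T p q) as [<-|Hpq].
    - rewrite <- Hd; symmetry; apply is_derive_unique.
      apply (is_derive_ext (fun x => (x - p) * g x)); [intros x; now rewrite Hfg|].
      assert (ex_derive g p) by apply smooth_ex_derive, Hg.
      auto_derive; [assumption|]; change (fun x0 => g x0) with g; ring.
    - apply Rmult_eq_reg_l with (q - p); [|lra].
      rewrite <- Hfg; replace (f q) with (f p - (f p - f q) / (p - q) * (p - q))
        by (field; lra).
      rewrite Hd, Hp; ring. }
  destruct (test_divide g q Hg Hq) as [h [Hh Hgh]].
  exists h; split; [exact Hh|]; intros x; now rewrite Hfg, Hgh.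
Qed.

Lemma divided_difference_minus (f g : R -> R) (p q : R) :
  ex_derive f p -> ex_derive g p ->
  divided_difference (fun x => f x - g x) p q =
    divided_difference f p q - divided_difference g p q.
Proof.
  intros Hf Hg; unfold divided_difference; destruct (Req_EM_T p q) as [_|Hpq].
  - now apply Derive_minus.
  - field; lra.
Qed.

(** The affine Newton interpolant of [f] at the nodes [p] and [q], Hermite when they coincide,
    evaluated at [z0]. *)
Definition newton_functional (z0 : C) (p q : R) (f : R -> R) : C :=
  (f p + divided_difference f p q * (z0 - p))%C.

(** A truncation [w] of the affine interpolant has the same nodal data as [f], so [f - w] is
    divisible by both factors and [L f = L w]. As the truncation widens, [L w] tends to the
    interpolant at [z0], while [L f] stays fixed. *)
Lemma functional_newton_on_test (E : (R -> R) -> C -> C) (z0 : C) (L : (R -> R) -> C)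
    (p q : R) (f : R -> R) :
  admissible_extension E -> upper_half_plane z0 -> bounded_linear_C1_0 L ->
  quadratically_tangent E z0 L ->
  (forall f, test f -> L (fun x => (x - p) * ((x - q) * f x)) = RtoC 0) ->
  test f -> L f = newton_functional z0 p q f.
Proof.
  intros HE Hz HL HT Hann Hf.
  set (D := divided_difference f p q).
  replace (L f) with ((L f - newton_functional z0 p q f) + newton_functional z0 p q f)%C
    by ring.
  rewrite (Cmod_eq_0 (_ - _)%C); [ring|].
  apply Rle_antisym; [|apply Cmod_ge_0].
  apply le_epsilon; intros eps Heps; rewrite Rplus_0_l.
  set (e := eps / (Rabs (f p) + Rabs D + 1)).
  generalize (Rabs_pos (f p)) (Rabs_pos D); intros Hfp HD.
  assert (He : 0 < e) by (apply Rdiv_lt_0_compat; lra).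
  assert (Hee : e * (Rabs (f p) + Rabs D + 1) = eps) by (unfold e; field; lra).
  clearbody e.
  destruct (affine_cutoff_limit E z0 L 0 1 HE Hz HL HT e He) as [N1 H1].
  destruct (affine_cutoff_limit E z0 L 1 (- p) HE Hz HL HT e He) as [N2 H2].
  (* Both nodes must lie strictly inside the region where the cutoffs are affine, derivative
     included. *)
  destruct (INR_unbounded (Rabs p + Rabs q)) as [N3 H3].
  set (N := (N1 + N2 + N3)%nat).
  specialize (H1 N ltac:(unfold N; lia)); specialize (H2 N ltac:(unfold N; lia)).
  assert (HN : INR N3 <= INR N) by (apply le_INR; unfold N; lia).
  generalize (Rabs_pos p) (Rabs_pos q); intros Hp0 Hq0.
  assert (Hp : Rabs p < INR N + 1) by lra.
  assert (Hq : Rabs q < INR N + 1) by lra.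
  set (u := affine_cutoff 0 1 N) in *; set (v := affine_cutoff 1 (- p) N) in *.
  assert (Hu : test u) by apply test_affine_cutoff.
  assert (Hv : test v) by apply test_affine_cutoff.
  assert (Hw := test_plus _ _ (test_scal (f p) u Hu) (test_scal D v Hv)).
  set (w := fun x => f p * u x + D * v x) in Hw.
  assert (HLw : L w = (f p * L u + D * L v)%C).
  { unfold w; rewrite (bl_plus L HL (fun x => f p * u x)), !(bl_scal L HL);
      auto using test_C1_0, test_scal. }
  assert (Hwp : w p = f p).
  { unfold w, u, v; rewrite !affine_cutoff_in by lra; ring. }
  assert (HwD : divided_difference w p q = D).
  { unfold divided_difference; destruct (Req_EM_T p q) as [Hpq|Hpq].
    - unfold w; rewrite Derive_plus, !Derive_scal.
      + unfold u, v; rewrite !Derive_affine_cutoff_in by exact Hp; ring.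
      + apply smooth_ex_derive, test_scal, Hu.
      + apply smooth_ex_derive, test_scal, Hv.
    - unfold w, u, v; rewrite !affine_cutoff_in by lra; field; lra. }
  assert (HLf : L f = L w).
  { destruct (test_divide_two (fun x => f x - w x) p q) as [g [Hg Hfg]].
    - now apply test_minus.
    - rewrite Hwp; ring.
    - rewrite divided_difference_minus, HwD by (apply smooth_ex_derive; apply Hf || apply Hw).
      unfold D; ring.
    - replace (L f) with (L f - L w + L w)%C by ring.
      rewrite <- (bl_minus_test L f w HL Hf Hw).
      replace (fun x => f x - w x) with (fun x => (x - p) * ((x - q) * g x))
        by (apply functional_extensionality; intros x; now rewrite Hfg).
      rewrite Hann by exact Hg; ring. }
  rewrite HLf, HLw; unfold newton_functional; fold D.
  replace (f p * L u + D * L v - (f p + D * (z0 - p)))%C with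
    (f p * (L u - (0 * z0 + 1)) + D * (L v - (1 * z0 + (- p)%R)))%C
    by (rewrite RtoC_opp; ring).
  apply Rle_trans with (1 := Cmod_triangle _ _).
  rewrite !Cmod_mult, !Cmod_R.
  assert (Rabs (f p) * Cmod (L u - (0 * z0 + 1))%C <= Rabs (f p) * e)
    by (apply Rmult_le_compat_l; lra).
  assert (Rabs D * Cmod (L v - (1 * z0 + (- p)%R))%C <= Rabs D * e)
    by (apply Rmult_le_compat_l; lra).
  lra.
Qed.

(** * Identification with the explicit family and passage to [C1_0] *)

Lemma newton_functional_bound (z0 : C) (p q : R) :
  exists K, 0 <= K /\ forall f d, (forall x, Rabs (f x) <= d) ->
    (forall x, Rabs (Derive f x) <= d) -> Cmod (newton_functional z0 p q f) <= K * d.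
Proof.
  assert (Hdd : exists K, 0 <= K /\ forall f d, (forall x, Rabs (f x) <= d) ->
    (forall x, Rabs (Derive f x) <= d) -> Rabs (divided_difference f p q) <= K * d).
  { unfold divided_difference; destruct (Req_EM_T p q) as [_|Hpq].
    - exists 1; split; [lra|]; intros f d _ H; rewrite Rmult_1_l; apply H.
    - assert (Hi : 0 < / Rabs (p - q)) by (apply Rinv_0_lt_compat, Rabs_pos_lt; lra).
      exists (2 * / Rabs (p - q)); split; [lra|]; intros f d H _.
      unfold Rdiv; rewrite Rabs_mult, Rabs_inv.
      assert (Rabs (f p - f q) <= 2 * d).
      { apply Rle_trans with (1 := Rabs_triang _ _); rewrite Rabs_Ropp.
        generalize (H p) (H q); lra. }
      apply Rle_trans with (2 * d * / Rabs (p - q)); [|right; ring].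
      apply Rmult_le_compat_r; lra. }
  destruct Hdd as [K [HK HKb]].
  exists (1 + K * Cmod (z0 - p)%C); split.
  { generalize (Rmult_le_pos _ _ HK (Cmod_ge_0 (z0 - p)%C)); lra. }
  intros f d H1 H2; unfold newton_functional.
  apply Rle_trans with (1 := Cmod_triangle _ _); rewrite Cmod_mult, !Cmod_R.
  generalize (H1 p) (Rmult_le_compat_r _ _ _ (Cmod_ge_0 (z0 - p)%C) (HKb f d H1 H2)); lra.
Qed.

(** With [a = p] and [alpha = p - q] the two evaluation points of [ext_family] are the nodes, and
    [z0] minus the first node is [(Ci - p) * Im z0]. The case [alpha = 0] is the confluent one, as
    [Im z0] is nonzero. *)
Lemma ext_family_newton (z0 : C) (p q : R) (f : R -> R) : upper_half_plane z0 ->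
  ext_family p (p - q) f z0 =
    newton_functional z0 (Re z0 + p * Im z0) (Re z0 + q * Im z0) f.
Proof.
  intros Hz; assert (Hy : 0 < Im z0) by exact Hz.
  unfold ext_family, newton_functional, divided_difference.
  replace (Re z0 - (p - q - p) * Im z0) with (Re z0 + q * Im z0) by ring.
  destruct (Req_EM_T (p - q) 0) as [Hpq|Hpq];
    destruct (Req_EM_T (Re z0 + p * Im z0) (Re z0 + q * Im z0)) as [Heq|Hneq].
  - apply injective_projections; simpl; fold (Re z0) (Im z0); ring.
  - exfalso; apply Hneq; replace p with q by lra; ring.
  - exfalso; apply Hpq, Rmult_eq_reg_r with (Im z0); lra.
  - assert (Hd : Re z0 + p * Im z0 - (Re z0 + q * Im z0) <> 0) by lra.
    apply injective_projections; simpl; fold (Re z0) (Im z0); field; repeat split; nra.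
Qed.

Lemma C1_0_minus (f g : R -> R) : C1_0 f -> C1_0 g -> C1_0 (fun x => f x - g x).
Proof.
  intros [[Hf Hfc] [F1 [F2 [F3 F4]]]] [[Hg Hgc] [G1 [G2 [G3 G4]]]].
  assert (HD : forall x, Derive f x - Derive g x = Derive (fun x => f x - g x) x)
    by (intros x; symmetry; now apply Derive_minus).
  assert (Hlim : forall u v l, is_lim u l 0 -> is_lim v l 0 -> is_lim (fun x => u x - v x) l 0).
  { intros u v l Hu Hv; replace (Finite 0) with (Finite (0 - 0)) by (f_equal; ring).
    now apply is_lim_minus'. }
  split; [split|split; [|split; [|split]]]; auto.
  - intros x; now apply (ex_derive_minus f g).
  - intros x; apply continuous_ext with (1 := HD).
    now apply (continuous_minus (V := R_NormedModule)).
  - apply is_lim_ext with (1 := HD); auto.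
  - apply is_lim_ext with (1 := HD); auto.
Qed.

Theorem theorem2 :
  forall (E : (R -> R) -> C -> C) (z0 : C) (eps0 : R)
    (Lambda Rem : (R -> R) -> C),
  admissible_extension E ->
  upper_half_plane z0 ->
  0 < eps0 < 1 ->
  bounded_linear_C1_0 Lambda ->
  (forall phi, B_infty eps0 phi ->
     E (fun x => x + phi x) z0 = (z0 + Lambda phi + Rem phi)%C) ->
  (forall c, 0 < c ->
     exists eps, 0 < eps < eps0 /\
     forall phi, B_infty eps phi ->
       Cmod (Rem phi) <= c * (sup_norm (Derive phi)) ^ 2) ->
  exists a alpha : R,
    0 <= alpha /\
    forall phi, C1_0 phi -> Lambda phi = ext_family a alpha phi z0.
Proof.
  intros E z0 eps0 L Rem HE Hz _ HL Hexp HRem.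
  assert (HT := expansion_quadratically_tangent E z0 eps0 L Rem Hexp HRem).
  destruct (two_point_annihilator E z0 L HE Hz HL HT) as [p [q [Hpq Hann]]].
  (* Ordering the roots as [q <= p] makes [alpha] nonnegative. *)
  exists p, (p - q); split; [lra|]; intros phi Hphi.
  rewrite ext_family_newton by exact Hz.
  set (P := Re z0 + p * Im z0) in *; set (Q := Re z0 + q * Im z0) in *.
  destruct (bounded_linear_bound L HL) as [M [HM HMb]].
  destruct (newton_functional_bound z0 P Q) as [K [HK HKb]].
  set (G := newton_functional z0 P Q) in *.
  replace (L phi) with ((L phi - G phi) + G phi)%C by ring.
  rewrite (Cmod_eq_0 (_ - _)%C); [ring|].
  apply Rle_antisym; [|apply Cmod_ge_0].
  apply le_epsilon; intros eps Heps; rewrite Rplus_0_l.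
  (* [L] and [G] agree on [psi] and have bounds [M] and [K] in the [C1] norm, so they differ on
     [phi] by at most [(M + K) * e]. *)
  set (e := eps / (M + K + 1)).
  assert (He : 0 < e) by (apply Rdiv_lt_0_compat; lra).
  assert (Hee : e * (M + K + 1) = eps) by (unfold e; field; lra).
  clearbody e.
  destruct (test_dense phi e Hphi He) as [psi [Hpsi Happ]].
  assert (Hpsi0 := test_C1_0 _ Hpsi).
  assert (Hd := C1_0_minus phi psi Hphi Hpsi0).
  assert (B0 : forall x, Rabs (phi x - psi x) <= e) by (intros x; apply Happ).
  assert (B1 : forall x, Rabs (Derive (fun x => phi x - psi x) x) <= e).
  { intros x; rewrite Derive_minus; [apply Happ | apply Hphi | apply Hpsi0]. }
  assert (HLs : L phi = (L (fun x => phi x - psi x)%R + L psi)%C).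
  { rewrite <- (bl_plus L HL) by assumption.
    f_equal; apply functional_extensionality; intros x; ring. }
  assert (HGs : G (fun x => phi x - psi x) = (G phi - G psi)%C).
  { unfold G, newton_functional.
    rewrite divided_difference_minus by (apply Hphi || apply Hpsi0).
    rewrite !RtoC_minus; ring. }
  assert (Ht : L psi = G psi) by now apply functional_newton_on_test with E.
  replace (L phi - G phi)%C with (L (fun x => phi x - psi x)%R + - G (fun x => phi x - psi x)%R)%C
    by (rewrite HLs, HGs, Ht; ring).
  apply Rle_trans with (1 := Cmod_triangle _ _); rewrite Cmod_opp.
  generalize (HMb _ e Hd B0 B1) (HKb _ e B0 B1); lra.
Qed.
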